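(* For every rooted boundedly-compact metric space $(S,d^S,\rho_S)$, the vague-and-point-process topology on $\mathcal M^{\mathrm{dis}}(S)$, i.e. the topology induced by the metric $d_{\mathcal M^{\mathrm{dis}}}^{S,\rho_S}$, is Polish. On the other hand, the metric $d_{\mathcal M^{\mathrm{dis}}}^{S,\rho_S}$ is not complete in general (i.e. there exists a rooted boundedly-compact metric space $(S,d^S,\rho_S)$ for which it is not complete).
   Context: A metric space is boundedly compact if all closed balls are compact; rooted means equipped with a distinguished point $\rho_S$. $B_S(x,r)$ denotes the open ball. $\mathcal M(S)$ is the set of Radon measures (Borel measures finite on compact sets). For $\mu\in\mathcal M(S)$ and $r>0$ let $S^{(r)}=\mathrm{cl}(B_S(\rho_S,r))$ and $\mu^{(r)}=\mu(\cdot\cap S^{(r)})$. With $A^{\langle\varepsilon\rangle}=\{x:\exists y\in A,\ d^S(x,y)\le\varepsilon\}$, the Prohorov metric on finite Borel measures is $d_P^S(\mu,\nu)=\inf\{\varepsilon>0:\mu(A)\le\nu(A^{\langle\varepsilon\rangle})+\varepsilon,\ \nu(A)\le\mu(A^{\langle\varepsilon\rangle})+\varepsilon\ \forall A\text{ Borel}\}$. The vague metric on $\mathcal M(S)$ is $d_V^{S,\rho_S}(\mu,\nu)=\int_0^\infty e^{-r}(1\wedge d_P^S(\mu^{(r)},\nu^{(r)}))dr$; it is a complete separable metric inducing the vague topology. $\mathcal M^{\mathrm{dis}}(S)$ is the set of discrete Radon measures, i.e. $\nu=\sum_{i\in I}w_i\delta_{x_i}\in\mathcal M(S)$ with $I$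 countable, $w_i>0$ and $x_i\ne x_j$ for $i\ne j$. Put $\mathfrak p(\nu)=\sum_{i\in I}\delta_{(x_i,w_i)}$, a Radon measure on $S\times\mathbb R_{>0}$. Here $\mathbb R_{>0}=(0,\infty)$ carries the metric $d^{\mathbb R_{>0}}(v,w)=|\log v-\log w|$, and $S\times\mathbb R_{>0}$ the max product metric and the root $\tilde\rho_S=(\rho_S,1)$. Define $$d_{\mathcal M^{\mathrm{dis}}}^{S,\rho_S}(\nu_1,\nu_2)=d_V^{S,\rho_S}(\nu_1,\nu_2)\vee d_V^{S\times\mathbb R_{>0},\tilde\rho_S}(\mathfrak p(\nu_1),\mathfrak p(\nu_2)).$$ *)

(* Defs.v *)
From HB Require Import structures.
From mathcomp Require Import all_boot all_order all_algebra.
From mathcomp Require Import all_classical all_reals all_analysis.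

Set Implicit Arguments.
Unset Strict Implicit.
Unset Printing Implicit Defensive.

Import Order.TTheory GRing.Theory Num.Theory.
Import numFieldNormedType.Exports.

Local Open Scope classical_set_scope.
Local Open Scope ring_scope.

Section distances.
Context {R : realType} {T : Type}.
Implicit Type d : T -> T -> R.

Definition is_metric d : Prop :=
  [/\ forall x, d x x = 0,
      forall x y, d x y = 0 -> x = y,
      forall x y, d x y = d y x &
      forall x y z, d x z <= d x y + d y z].

Definition complete_metric d : Prop :=
  forall u : nat -> T,
    (forall e : R, 0 < e -> \forall m & n \near \oo, d (u m) (u n) < e) ->
    exists l : T, d (u n) l @[n --> \oo] --> (0 : R).

Definition metric_open d : set_system T :=
  [set U | forall x, U x -> exists2 e : R, 0 < e & [set y | d x y < e] `<=` U].

(* A copy of T, whose topology instance is given by [metric_open d]. *)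
Definition metric_topology d : Type := T.

End distances.

Section metric_topology.
Context {R : realType} {T : Type} (d : T -> T -> R).

Let metric_openT : metric_open d setT.
Proof. by move=> x _; exists 1. Qed.

Let metric_openI : setI_closed (metric_open d).
Proof.
move=> A B oA oB x [/oA[e1 e10 A1] /oB[e2 e20 B2]].
exists (Num.min e1 e2); first by rewrite lt_min e10.
by move=> y /=; rewrite lt_min => /andP[? ?]; split; [exact: A1|exact: B2].
Qed.

Let metric_open_bigU (I : Type) (f : I -> set T) :
  (forall i, metric_open d (f i)) -> metric_open d (\bigcup_i f i).
Proof.
move=> of_ x [i _ /of_[e e0 ef]]; exists e => // y /ef fiy.
by exists i.
Qed.

HB.instance Definition _ := gen_eqMixin (metric_topology d).
HB.instance Definition _ := gen_choiceMixin (metric_topology d).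
HB.instance Definition _ := isOpenTopological.Build (metric_topology d)
  metric_openT metric_openI metric_open_bigU.

End metric_topology.

Definition separable (T : topologicalType) : Prop :=
  exists2 A : set T, countable A & dense A.

Definition completely_metrizable (R : realType) (T : topologicalType) : Prop :=
  exists d : T -> T -> R,
    [/\ is_metric d, complete_metric d & @open T = metric_open d].

Definition polish (R : realType) (T : topologicalType) : Prop :=
  separable T /\ completely_metrizable R T.

(* The root is the distinguished element [point] of the pointed structure. *)
#[short(type="rootedMetricType")]
HB.structure Definition RootedMetric (R : numDomainType) :=
  {T of Metric R T & isPointed T}.

(* Not the library's [closed_ball], which is the closure of an open ball. *)
Definition boundedly_compact (R : realType) (S : metricType R) : Prop :=
  forall (x : S) (r : R), compact [set y : S | mdist x y <= r].

Section prod_metric.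
Context {R : numDomainType} {U V : metricType R}.
Implicit Types x y : U * V.

Definition prod_mdist x y : R :=
  Num.max (mdist x.1 y.1) (mdist x.2 y.2).

Let prod_mdist_ge0 x y : 0 <= prod_mdist x y.
Proof. by rewrite /prod_mdist /Order.max; case: ifP; rewrite mdist_ge0. Qed.

Let mdist_cmp x y : (mdist x.1 y.1 >=< mdist x.2 y.2)%R.
Proof. by rewrite real_comparable// ger0_real// mdist_ge0. Qed.

Let prod_mdist_eq0 x y : prod_mdist x y = 0 -> x = y.
Proof.
move=> xy0; have: prod_mdist x y <= 0 by rewrite xy0.
rewrite /prod_mdist comparable_ge_max// => /andP[xy1 xy2].
case: x y xy1 xy2 {xy0} => [x1 x2] [y1 y2] /= xy1 xy2; congr pair;
  by apply: mdist_positivity; apply/eqP; rewrite eq_le mdist_ge0 andbT.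
Qed.

Let prod_ballE x (e : R) : ball x e = [set y | prod_mdist x y < e].
Proof.
rewrite /ball/= /prod_ball !ballEmdist; apply/seteqP; split => y /=.
  by move=> [xy1 xy2]; rewrite /prod_mdist comparable_gt_max// xy1.
by rewrite /prod_mdist comparable_gt_max// => /andP[].
Qed.

HB.instance Definition _ := PseudoMetric_isMetric.Build R (U * V)%type
  prod_mdist_ge0 prod_mdist_eq0 prod_ballE.

End prod_metric.

HB.instance Definition _ (R : numDomainType) (U V : rootedMetricType R) :=
  Metric.on (U * V)%type.

Definition posreal (R : realType) : Type := {posnum R}.

Section posreal_metric.
Context {R : realType}.
Implicit Types v w : posreal R.

Definition log_dist v w : R :=
  `|ln (v : {posnum R})%:num - ln (w : {posnum R})%:num|.

Let log_distxx v : log_dist v v = 0.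
Proof. by rewrite /log_dist subrr normr0. Qed.

Let log_dist_eq0 v w : log_dist v w = 0 -> v = w.
Proof.
move/normr0_eq0/eqP; rewrite subr_eq0 => /eqP vw; apply/val_inj => /=.
by apply: ln_inj vw; rewrite posrE.
Qed.

Let log_distC v w : log_dist v w = log_dist w v.
Proof. exact: distrC. Qed.

Let log_dist_triangle v u w : log_dist u w <= log_dist u v + log_dist v w.
Proof. exact: ler_distD. Qed.

HB.instance Definition _ := Choice.copy (posreal R) {posnum R}.
HB.instance Definition _ := isPointed.Build (posreal R) (1%:pos : {posnum R}).
HB.instance Definition _ := isMetric.Build R (posreal R)
  log_distxx log_dist_eq0 log_distC log_dist_triangle.

End posreal_metric.

Definition borel (R : realType) (X : rootedMetricType R) :=
  g_sigma_algebraType (@open X).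

Section vague.
Context {R : realType} {X : rootedMetricType R}.
Implicit Type mu nu : {measure set (borel X) -> \bar R}.

(* A library measure is a function on all subsets, constrained on measurable
   sets only. The last field fixes the irrelevant values on non-Borel sets to be
   those of the outer measure, so that two Radon measures are equal as soon as
   they agree on Borel sets. *)
Record radon_measure : Type := RadonMeasure {
  radon_val :> {measure set (borel X) -> \bar R} ;
  _ : forall K : set X, compact K -> (radon_val K < +oo)%E ;
  _ : forall A : set X, radon_val A = (radon_val^* A)%mu }.

Definition truncset (r : R) : set X := closure (ball (point : X) r).

Lemma measurable_truncset r : measurable (truncset r : set (borel X)).
Proof.
rewrite -[truncset r]setCK; apply: measurableC; apply: sub_sigma_algebra.
exact/closed_openC/closed_closure.
Qed.

Definition truncate mu (r : R) : {measure set (borel X) -> \bar R} :=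
  mrestr mu (measurable_truncset r).

Definition thickening (A : set X) (e : R) : set X :=
  [set x | exists2 y, A y & mdist x y <= e].

(* The closed thickening of a Borel set is an analytic set that need not be
   Borel, hence its measure is taken in the sense of the outer measure, which
   extends both the measure and its completion. *)
Definition prohorov_dist mu nu : R :=
  inf [set e : R | 0 < e /\
    forall A : set (borel X), measurable A ->
      (mu A <= (nu^* (thickening A e))%mu + e%:E)%E /\
      (nu A <= (mu^* (thickening A e))%mu + e%:E)%E].

Definition vague_dist mu nu : R :=
  (\int[lebesgue_measure]_(r in `]0%R, +oo[)
     (expR (- r) * Num.min 1 (prohorov_dist (truncate mu r) (truncate nu r))))%R.

End vague.

Arguments radon_measure {R} X.

(* The measure \sum_(i in I) c i * \d_(x i). *)
Definition dirac_sum (R : realType) (X : rootedMetricType R)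
    (I : set nat) (c : nat -> {nonneg R}) (x : nat -> borel X) :
    {measure set (borel X) -> \bar R} :=
  mseries (fun i =>
    if i \in I then mscale (c i) \d_(x i) : {measure set _ -> \bar R}
    else mzero) 0.

Section discrete.
Context {R : realType} {S : rootedMetricType R}.

(* Countable families are indexed by subsets of nat. *)
Record atoms : Type := Atoms {
  atom_idx : set nat ;
  atom_pos : nat -> S ;
  atom_wt : nat -> posreal R ;
  atom_inj : set_inj atom_idx atom_pos }.

Definition atoms_of (nu : radon_measure S) (a : atoms) : Prop :=
  forall A : set (borel S), measurable A ->
    nu A = dirac_sum (atom_idx a)
             (fun i => (atom_wt a i : {posnum R})%:num%:nng) (atom_pos a) A.

Record discrete_measure : Type := DiscreteMeasure {
  discrete_val :> radon_measure S ;
  discrete_atoms : exists a : atoms, atoms_of discrete_val a }.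

(* The family of atoms is unique up to reindexing, and the point process below
   does not depend on the one that is chosen. *)
Definition point_process (nu : discrete_measure) :
    {measure set (borel (S * posreal R)%type) -> \bar R} :=
  let a := sval (cid (discrete_atoms nu)) in
  dirac_sum (atom_idx a) (fun=> 1%:nng) (fun i => (atom_pos a i, atom_wt a i)).

Definition discrete_dist (nu1 nu2 : discrete_measure) : R :=
  Num.max (vague_dist nu1 nu2)
          (vague_dist (point_process nu1) (point_process nu2)).

End discrete.

Arguments discrete_measure {R} S.
Arguments discrete_dist {R} S.

(* Main.v *)
(* On large balls the vague metric amounts to comparing the measure of a Borel set
   with that of its thickenings: smallness of [vague_dist] gives such comparisons
   uniformly, and conversely they force [vague_dist] to 0 by dominated convergence,
   because the mass of the ball of radius [r] has only countably many jumps in [r].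

   A discrete measure is determined by its set of atoms (position, weight) in
   S * R_{>0}. A Cauchy sequence can only fail to converge to a discrete measure
   because mass escapes through atoms of vanishing weight or because two atoms
   collide. Locally around each discrete measure both phenomena are uniformly
   controlled, and by Cech's criterion an equivalent metric forces this control
   along its Cauchy sequences. The limit is then the set of the limits of atoms.
   Separability follows by approximating the finitely many relevant atoms by points
   of a dense sequence.

   On the real line the measures delta_0 + delta_{1/n} form a Cauchy sequence. Their
   point processes tend to 2 delta_(0,1), which does not come from any discrete
   measure. *)
Require Import Defs.
From HB Require Import structures.
From mathcomp Require Import all_boot all_order all_algebra.
From mathcomp Require Import finmap.
From mathcomp Require Import all_classical all_reals all_analysis.
From mathcomp Require Import measurable_realfun ring lra.

Set Implicit Arguments.
Unset Strict Implicit.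
Unset Printing Implicit Defensive.

Import Order.TTheory GRing.Theory Num.Theory.
Import numFieldNormedType.Exports.

Local Open Scope classical_set_scope.
Local Open Scope ring_scope.

(** * Open thickenings and the Prohorov metric *)

(** The two halves of the distance control complementary things. The ball of radius [r] around the
    root of [S * posreal R] sees only atoms of weight between [expR (- r)] and [expR r]. Closeness
    of the point processes therefore locates any given atom but says nothing about the light ones.
    Their mass is what remains once the located atoms are subtracted from the total mass, and
    closeness of the measures controls it. Conversely, a set of atoms of total mass below
    [expR (- r)] has no member in that ball, so a bound on leftover mass also governs the point
    process. An injective matching of atoms with small displacement and small leftover mass thus
    serves both metrics at once. The vague metric is studied for all locally finite measures and not
    only for discrete ones, because the counterexample is analysed through its distance to double
    Dirac masses that lie outside the space. *)

Section metric_space.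
Context {R : realType} {X : rootedMetricType R}.
Implicit Types (A B : set X) (x y : X) (e r : R).

Definition nbh A e : set X := [set x | exists2 y, A y & mdist x y < e].

Lemma mdist_open A :
  (forall x, A x -> exists2 e : R, 0 < e & forall y, mdist x y < e -> A y) ->
  open A.
Proof.
move=> h; rewrite openE => x /h[e e0 he]; apply/nbhs_ballP; exists e => //=.
by rewrite ballEmdist => y /= /he.
Qed.

Lemma ball_mdistP x e y : ball x e y <-> mdist x y < e.
Proof. by rewrite ballEmdist. Qed.

Lemma nbh_open A e : open (nbh A e).
Proof.
apply: mdist_open => x [y Ay xy]; exists (e - mdist x y); first by rewrite subr_gt0.
move=> z xz; exists y => //.
have := metric_triangle z x y; rewrite (metric_sym z x); lra.
Qed.

Lemma sub_nbh A e : 0 < e -> A `<=` nbh A e.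
Proof. by move=> e0 x Ax; exists x => //; rewrite mdistxx. Qed.

Lemma nbhS A B e e' : A `<=` B -> e <= e' -> nbh A e `<=` nbh B e'.
Proof. by move=> AB ee x [y /AB By xy]; exists y => //; apply: lt_le_trans ee. Qed.

Lemma nbh_nbh A e e' : nbh (nbh A e) e' `<=` nbh A (e + e').
Proof.
move=> x [y [z Az yz] xy]; exists z => //.
by have := metric_triangle x y z; lra.
Qed.

Lemma nbh_ball x r e : nbh (ball x r) e `<=` ball x (r + e).
Proof.
move=> y [z /ball_mdistP xz yz]; apply/ball_mdistP.
have := metric_triangle x z y; rewrite (metric_sym z y); lra.
Qed.

Lemma nbh_thickening A e : nbh A e `<=` thickening A e.
Proof. by move=> x [y Ay /ltW]; exists y. Qed.

Lemma thickening_nbh A e e' : e < e' -> thickening A e `<=` nbh A e'.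
Proof. by move=> ee x [y Ay xy]; exists y => //; exact: le_lt_trans ee. Qed.

Lemma borel_open A : open A -> measurable (A : set (borel X)).
Proof. by move=> oA; apply: sub_sigma_algebra. Qed.

Lemma borel_closed A : closed A -> measurable (A : set (borel X)).
Proof.
move=> cA; rewrite -[A]setCK; apply: measurableC; apply: borel_open.
exact: closed_openC.
Qed.

Lemma borel_nbh A e : measurable (nbh A e : set (borel X)).
Proof. by apply: borel_open; exact: nbh_open. Qed.

Lemma borel_ball x e : measurable (ball x e : set (borel X)).
Proof.
apply: borel_open; apply: mdist_open => y /ball_mdistP xy; exists (e - mdist x y).
  by rewrite subr_gt0.
by move=> z yz; apply/ball_mdistP; have := metric_triangle x y z; lra.
Qed.

Lemma borel_set1 (x : X) : measurable ([set x] : set (borel X)).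
Proof.
apply: borel_closed; apply: accessible_closed_set1; apply: hausdorff_accessible.
exact: metric_hausdorff.
Qed.

Lemma sub_truncset r : ball point r `<=` @truncset R X r.
Proof. exact: subset_closure. Qed.

Lemma truncset_mdist r x : @truncset R X r x -> mdist point x <= r.
Proof.
move=> cx; rewrite leNgt; apply/negP => rx.
have /cx[y [/ball_mdistP py /ball_mdistP xy]] : nbhs x (ball x (mdist point x - r)).
  by apply: nbhsx_ballx; rewrite subr_gt0.
have := metric_triangle point y x; rewrite (metric_sym y x); lra.
Qed.

Lemma truncset_ball r r' : r < r' -> @truncset R X r `<=` ball point r'.
Proof. by move=> rr x /truncset_mdist xr; apply/ball_mdistP; exact: le_lt_trans rr. Qed.

Lemma truncsetS r r' : r <= r' -> @truncset R X r `<=` @truncset R X r'.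
Proof.
by move=> rr; apply: closure_subset => x /ball_mdistP xr; apply/ball_mdistP/(lt_le_trans xr).
Qed.

End metric_space.

Section prohorov.
Context {R : realType} {X : rootedMetricType R}.
Implicit Types (mu nu la : {measure set (borel X) -> \bar R}) (e : R).
Local Open Scope ereal_scope.

Lemma le_borel mu (A B : set (borel X)) : measurable A -> measurable B ->
  A `<=` B -> mu A <= mu B.
Proof. by move=> mA mB AB; rewrite le_measure ?inE. Qed.

(* Open thickenings are Borel, and using them instead of the closed ones does not
   change the infimum that defines [prohorov_dist]. *)
Definition prohorov_close mu nu e := forall A : set (borel X), measurable A ->
  mu A <= nu (nbh A e) + e%:E /\ nu A <= mu (nbh A e) + e%:E.

Lemma prohorov_dist_le mu nu e : (0 < e)%R -> prohorov_close mu nu e ->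
  (prohorov_dist mu nu <= e)%R.
Proof.
move=> e0 h; apply: ge_inf => /=; first by exists 0%R => x [/ltW].
split => // A mA; have [h1 h2] := h A mA; split.
  apply: (le_trans h1); rewrite leeD2r// -[leLHS](measurable_mu_extE nu).
    exact/le_mu_ext/nbh_thickening.
  exact: borel_nbh.
apply: (le_trans h2); rewrite leeD2r// -[leLHS](measurable_mu_extE mu).
  exact/le_mu_ext/nbh_thickening.
exact: borel_nbh.
Qed.

(** Finite total masses make the set under the infimum nonempty. An empty set would have infimum 0
    by convention, and the inequality on the distance would then carry no information. *)
Lemma prohorov_dist_lt mu nu e : mu setT < +oo -> nu setT < +oo ->
  (prohorov_dist mu nu < e)%R -> prohorov_close mu nu e.
Proof.
move=> fmu fnu; rewrite /prohorov_dist; set E := (X in inf X) => h.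
have hinf : has_inf E.
  split; last by exists 0%R => x [/ltW].
  exists (fine (mu setT) + fine (nu setT) + 1)%R; split.
    by rewrite ltr_wpDl// addr_ge0// fine_ge0.
  move=> A mA.
  have le1 la : la setT < +oo -> la A <= (fine (la setT))%:E.
    by move=> fla; rewrite fineK ?ge0_fin_numE// le_measure ?inE.
  split.
    apply: (le_trans (le1 _ fmu)); rewrite -[leLHS]add0e leeD ?mu_ext_ge0//.
    by rewrite lee_fin -addrA lerDl addr_ge0// fine_ge0.
  apply: (le_trans (le1 _ fnu)); rewrite -[leLHS]add0e leeD ?mu_ext_ge0//.
  by rewrite lee_fin addrAC lerDr addr_ge0// fine_ge0.
have [e' [e'0 he'] e'e] := inf_lt hinf.1 h.
move=> A mA; have [h1 h2] := he' A mA; split.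
  apply: (le_trans h1); apply: leeD; last by rewrite lee_fin ltW.
  rewrite -[leRHS](measurable_mu_extE nu); last exact: borel_nbh.
  by apply: le_mu_ext; exact: thickening_nbh.
apply: (le_trans h2); apply: leeD; last by rewrite lee_fin ltW.
rewrite -[leRHS](measurable_mu_extE mu); last exact: borel_nbh.
by apply: le_mu_ext; exact: thickening_nbh.
Qed.

Lemma prohorov_dist_ge0 mu nu : (0 <= prohorov_dist mu nu)%R.
Proof.
rewrite /prohorov_dist; set E := (X in inf X).
have [->|/set0P E0] := eqVneq E set0; first by rewrite inf0.
by apply: lb_le_inf => // x [/ltW].
Qed.

Lemma prohorov_distC mu nu : prohorov_dist mu nu = prohorov_dist nu mu.
Proof.
by rewrite /prohorov_dist; congr inf; apply/seteqP; split => e [e0 h]; split => // A /h[].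
Qed.

Lemma prohorov_distxx mu : prohorov_dist mu mu = 0%R.
Proof.
apply/eqP; rewrite eq_le prohorov_dist_ge0 andbT; apply/ler_addgt0Pl => e e0.
rewrite addr0; apply: prohorov_dist_le => // A mA.
have : mu A <= mu (nbh A e) + e%:E.
  rewrite -[leLHS]adde0; apply: leeD; last by rewrite lee_fin ltW.
  by apply: le_borel => //; [exact: borel_nbh|exact: sub_nbh].
by split.
Qed.

Lemma prohorov_close_trans mu nu la e e' :
  prohorov_close mu nu e -> prohorov_close nu la e' -> prohorov_close mu la (e + e').
Proof.
have half mu' nu' la' (d d' : R) (A : set (borel X)) : measurable A ->
    mu' A <= nu' (nbh A d) + d%:E -> nu' (nbh A d) <= la' (nbh (nbh A d) d') + d'%:E ->
    mu' A <= la' (nbh A (d + d')) + (d + d')%:E.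
  move=> mA h1 h2; apply: (le_trans h1); rewrite EFinD addeA addeAC leeD2r//.
  apply: (le_trans h2); rewrite leeD2r//.
  by apply: le_borel; [exact: borel_nbh..|exact: nbh_nbh].
move=> h1 h2 A mA; split.
  apply: (half _ nu) => //; first exact: (h1 A mA).1.
  by apply: (h2 _ _).1; exact: borel_nbh.
rewrite (addrC e); apply: (half _ nu) => //; first exact: (h2 A mA).2.
by apply: (h1 _ _).2; exact: borel_nbh.
Qed.

Lemma prohorov_dist_triangle mu nu la : mu setT < +oo -> nu setT < +oo ->
  la setT < +oo ->
  (prohorov_dist mu la <= prohorov_dist mu nu + prohorov_dist nu la)%R.
Proof.
move=> fmu fnu fla; apply/ler_addgt0Pr => e e0.
set a := prohorov_dist mu nu; set b := prohorov_dist nu la.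
have -> : (a + b + e = (a + e / 2) + (b + e / 2))%R by lra.
have a0 : (0 <= a)%R := prohorov_dist_ge0 _ _.
have b0 : (0 <= b)%R := prohorov_dist_ge0 _ _.
apply: prohorov_dist_le; first lra.
by apply: (@prohorov_close_trans _ nu); apply: prohorov_dist_lt => //; rewrite -/a -/b; lra.
Qed.

End prohorov.

(** * The vague metric *)

(** Where the two one-sided limits of [f] agree, [f (r + d)] and [f (r - d)] both approach the
    common value, so each exceptional [r] is a discontinuity. Discontinuities are counted on bounded
    intervals, hence the union over []-n, n[]. *)
Lemma nondecreasing_jumps (R : realType) (f : R -> R) :
  {homo f : x y / x <= y} ->
  countable [set r | ~ forall e, 0 < e -> exists2 d, 0 < d & f (r + d) - f (r - d) < e].
Proof.
move=> ndf; set J := (X in countable X).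
have cJ : countable (\bigcup_(n in [set: nat])
    [set x | x \in (`]- n%:R, n%:R[ : interval R) /\ discontinuity f x]).
  by apply: bigcup_countable => // n _; apply: discontinuity_countable => x y _ _; exact: ndf.
apply: sub_countable cJ; apply: subset_card_le => r Jr.
exists (Num.truncn `|r|).+1 => //=.
have := truncnS_gt `|r|; rewrite ltr_norml => /andP[nr rn]; split.
  by rewrite in_itv/= nr rn.
have cl : cvg (f x @[x --> r^'-]).
  apply: nondecreasing_at_left_is_cvgr.
    by near=> x => y z _ _; exact: ndf.
  near=> x; exists (f r) => _ [y /=] + <-; rewrite in_itv/= => /andP[_ yr].
  exact/ndf/ltW.
have cr : cvg (f x @[x --> r^'+]).
  apply: nondecreasing_at_right_is_cvgr.
    by near=> x => y z _ _; exact: ndf.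
  near=> x; exists (f r) => _ [y /=] + <-; rewrite in_itv/= => /andP[yr _].
  exact/ndf/ltW.
split => //; apply/eqP => lr; apply: Jr => e e0.
set l := lim _ in lr.
have e20 : 0 < e / 2 by rewrite divr_gt0.
have /cvgrPdist_lt/(_ _ e20) [/= d1 d10 h1] : f x @[x --> r^'-] --> l by [].
have /cvgrPdist_lt/(_ _ e20) [/= d2 d20 h2] : f x @[x --> r^'+] --> l by rewrite lr.
exists (Num.min d1 d2 / 2); first by rewrite divr_gt0// lt_min d10.
set d := _ / 2; have d0 : 0 < d by rewrite divr_gt0// lt_min d10.
have dd : d < Num.min d1 d2.
  by rewrite /d ltr_pdivrMr// ltr_pMr ?ltr1n// lt_min d10.
move: dd; rewrite lt_min => /andP[dd1 dd2].
have n1 : ball_ Num.norm r d1 (r - d) by rewrite /ball_/= opprB addrC subrK gtr0_norm.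
have n2 : ball_ Num.norm r d2 (r + d) by rewrite /ball_/= opprD addrA subrr sub0r normrN gtr0_norm.
have rd : r - d < r by rewrite gtrBl.
have dr : r < r + d by rewrite ltrDl.
have := h1 _ n1 rd; have := h2 _ n2 dr; rewrite /=.
rewrite !ltr_norml; lra.
Unshelve. all: by end_near. Qed.

Lemma min1_lip (R : realType) (a b c : R) :
  0 <= c -> a <= b + c -> Num.min 1 a <= Num.min 1 b + c.
Proof. by rewrite !minEle; case: ifPn => ?; case: ifPn => ?; lra. Qed.

Lemma min1D (R : realType) (a b c : R) : 0 <= a -> 0 <= b ->
  c <= a + b -> Num.min 1 c <= Num.min 1 a + Num.min 1 b.
Proof. by rewrite !minEle; case: ifPn => ?; case: ifPn => ?; case: ifPn => ?; lra. Qed.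

Section vague.
Context {R : realType} {X : rootedMetricType R}.
Implicit Types (mu nu la : {measure set (borel X) -> \bar R}) (e r : R).

Definition locally_finite mu := forall r, (mu (@truncset R X r) < +oo)%E.

Definition trunc_mass mu r := fine (mu (@truncset R X r)).

(* The factor [1 + e] absorbs the perturbation of the weights of the atoms. *)
Definition vague_close mu nu r e := forall A : set (borel X), measurable A ->
  A `<=` ball (point : X) r -> (mu A <= (1 + e)%:E * nu (nbh A e) + e%:E)%E.

Definition vague_integrand mu nu r :=
  expR (- r) * Num.min 1 (prohorov_dist (truncate mu r) (truncate nu r)).

Lemma truncateE mu r (A : set (borel X)) :
  truncate mu r A = mu (A `&` @truncset R X r).
Proof. by []. Qed.

Lemma truncate_fin mu r : locally_finite mu -> (truncate mu r setT < +oo)%E.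
Proof. by move=> fmu; rewrite truncateE setTI. Qed.

Lemma trunc_massE mu r : locally_finite mu ->
  mu (@truncset R X r) = (trunc_mass mu r)%:E.
Proof. by move=> fmu; rewrite fineK// ge0_fin_numE. Qed.

Lemma locally_finite_le mu r (A : set (borel X)) : locally_finite mu ->
  measurable A -> A `<=` @truncset R X r -> mu A = (fine (mu A))%:E.
Proof.
move=> fmu mA Ar; rewrite fineK// ge0_fin_numE// (le_lt_trans _ (fmu r))//.
by apply: le_borel => //; exact: measurable_truncset.
Qed.

Lemma trunc_mass_nd mu : locally_finite mu ->
  {homo trunc_mass mu : x y / x <= y}.
Proof.
move=> fmu x y xy; rewrite -lee_fin -!trunc_massE//.
by apply: le_borel; [exact: measurable_truncset..|exact: truncsetS].
Qed.

Lemma truncate_le mu r r' (A : set (borel X)) : locally_finite mu ->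
  measurable A -> r <= r' ->
  (mu (A `&` @truncset R X r') <=
   mu (A `&` @truncset R X r) + (trunc_mass mu r' - trunc_mass mu r)%:E)%E.
Proof.
move=> fmu mA rr.
have mS s := @measurable_truncset R X s.
have -> : (trunc_mass mu r' - trunc_mass mu r)%:E =
    mu (@truncset R X r' `\` @truncset R X r).
  rewrite EFinB -!trunc_massE// measureD//; last exact: fmu.
  by congr (_ - mu _)%E; rewrite setIC; apply/esym/setIidl/truncsetS.
have mD : measurable (@truncset R X r' `\` @truncset R X r : set (borel X)).
  exact: measurableD.
apply: (@le_trans _ _
  (mu ((A `&` @truncset R X r) `|` (@truncset R X r' `\` @truncset R X r)))).
  apply: le_borel; [exact: measurableI|by apply: measurableU => //; exact: measurableI|].
  move=> x [Ax r'x]; have [rx|rx] := pselect (@truncset R X r x); first by left.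
  by right.
by apply: measureU2 => //; exact: measurableI.
Qed.

Lemma prohorov_dist_truncate mu r r' : locally_finite mu -> r <= r' ->
  prohorov_dist (truncate mu r) (truncate mu r') <= trunc_mass mu r' - trunc_mass mu r.
Proof.
move=> fmu rr; apply/ler_addgt0Pl => e e0.
have m0 : 0 <= trunc_mass mu r' - trunc_mass mu r.
  by rewrite subr_ge0 trunc_mass_nd.
apply: prohorov_dist_le; first lra.
set d := e + _; have d0 : 0 < d by rewrite /d; lra.
move=> A mA; rewrite !truncateE.
have mS s := @measurable_truncset R X s.
have mI (B : set (borel X)) s : measurable B -> measurable (B `&` @truncset R X s : set (borel X)).
  by move=> mB; exact: measurableI.
have mN : measurable (nbh A d : set (borel X)) := borel_nbh _ _.
split.
  rewrite -[leLHS]adde0; apply: leeD; last by rewrite lee_fin ltW.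
  by apply: le_borel; [exact: mI..|apply: setISS; [exact: sub_nbh|exact: truncsetS]].
apply: (le_trans (truncate_le fmu mA rr)); apply: leeD.
  by apply: le_borel; [exact: mI..|apply: setISS; first exact: sub_nbh].
by rewrite lee_fin /d lerDr ltW.
Qed.

(** A quadrilateral inequality between the four truncated measures. It bounds the variation in [r]
    of the Prohorov distance by that of a monotone function, which is how measurability of the
    integrand is obtained. *)
Lemma prohorov_dist_truncate2 mu nu r r' : locally_finite mu -> locally_finite nu ->
  r <= r' ->
  `|prohorov_dist (truncate mu r) (truncate nu r) -
    prohorov_dist (truncate mu r') (truncate nu r')| <=
  (trunc_mass mu r' + trunc_mass nu r') - (trunc_mass mu r + trunc_mass nu r).
Proof.
move=> fmu fnu rr.
have f s := truncate_fin s fmu; have f' s := truncate_fin s fnu.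
have h1 := prohorov_dist_truncate fmu rr; have h2 := prohorov_dist_truncate fnu rr.
have := prohorov_dist_triangle (f r) (f r') (f' r).
have := prohorov_dist_triangle (f r') (f r) (f' r').
have := prohorov_dist_triangle (f r') (f' r') (f' r).
have := prohorov_dist_triangle (f r) (f' r) (f' r').
rewrite (prohorov_distC (truncate mu r') (truncate mu r)).
rewrite (prohorov_distC (truncate nu r') (truncate nu r)).
move: h1 h2; rewrite ler_norml.
move: (prohorov_dist _ _) (trunc_mass _ _) (trunc_mass _ _) (prohorov_dist _ _)
  (trunc_mass _ _) (trunc_mass _ _) => a1 a2 a3 a4 a5 a6.
move: (prohorov_dist _ _) (prohorov_dist _ _) (prohorov_dist _ _) (prohorov_dist _ _)
   => b1 b2 b3 b4.
clear; lra.
Qed.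

Lemma vague_integrand_measurable mu nu D : locally_finite mu -> locally_finite nu ->
  measurable D -> measurable_fun D (vague_integrand mu nu).
Proof.
move=> fmu fnu mD.
(* [p] varies by at most as much as the monotone [m], hence [p + m] is monotone. *)
pose m r := trunc_mass mu r + trunc_mass nu r.
pose p r := Num.min 1 (prohorov_dist (truncate mu r) (truncate nu r)).
have ndm : {homo m : x y / x <= y} by move=> x y xy; rewrite lerD ?trunc_mass_nd.
have mm : measurable_fun D m by exact: nondecreasing_measurable.
have mpm : measurable_fun D (p \+ m).
  apply: nondecreasing_measurable => // x y xy /=.
  rewrite -lerBrDr -addrA; apply: min1_lip; first by rewrite subr_ge0 ndm.
  rewrite -lerBlDl; apply: le_trans (ler_norm _) _.
  exact: prohorov_dist_truncate2.
have mp : measurable_fun D p.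
  rewrite (_ : p = (p \+ m) \- m); first exact: measurable_funB.
  by apply/funext => x /=; rewrite addrK.
rewrite (_ : vague_integrand mu nu = (fun r => expR (- r)) \* p)//.
apply: measurable_funM => //.
by apply: measurableT_comp => //; exact: measurableT_comp.
Qed.

Lemma vague_integrand_ge0 mu nu r : 0 <= vague_integrand mu nu r.
Proof. by rewrite mulr_ge0 ?expR_ge0// le_min ler01 prohorov_dist_ge0. Qed.

Lemma vague_integrand_le mu nu r : vague_integrand mu nu r <= expR (- r).
Proof. by rewrite ler_piMr ?expR_ge0// ge_min lexx. Qed.

Lemma integrable_expRN :
  lebesgue_measure.-integrable `]0%R, +oo[ (EFin \o (fun r : R => expR (- r))).
Proof.
have h : lebesgue_measure.-integrable `]0%R, +oo[ (EFin \o exponential_pdf (1 : R)).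
  by apply: integrableS (integrable_exponential_pdf ltr01).
apply: eq_integrable h => // x; rewrite inE/= in_itv/= andbT => x0.
by rewrite exponential_pdfE ?ltW// mul1r mulN1r.
Qed.

Lemma integrable_vague mu nu : locally_finite mu -> locally_finite nu ->
  lebesgue_measure.-integrable `]0%R, +oo[ (EFin \o vague_integrand mu nu).
Proof.
move=> fmu fnu; apply: le_integrable integrable_expRN => //.
  by apply/measurable_EFinP; exact: vague_integrand_measurable.
move=> x _ /=; rewrite lee_fin !ger0_norm ?expR_ge0 ?vague_integrand_ge0//.
exact: vague_integrand_le.
Qed.

Lemma vague_dist_ge0 mu nu : 0 <= vague_dist mu nu.
Proof. by apply: Rintegral_ge0 => x _; exact: vague_integrand_ge0. Qed.

Lemma vague_distxx mu : vague_dist mu mu = 0.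
Proof.
rewrite /vague_dist /Rintegral integral0_eq// => x _.
by rewrite prohorov_distxx min_r// mulr0.
Qed.

Lemma vague_distC mu nu : vague_dist mu nu = vague_dist nu mu.
Proof. by apply: eq_Rintegral => x _; rewrite prohorov_distC. Qed.

Lemma vague_dist_triangle mu nu la : locally_finite mu -> locally_finite nu ->
  locally_finite la ->
  vague_dist mu la <= vague_dist mu nu + vague_dist nu la.
Proof.
move=> fmu fnu fla.
rewrite /vague_dist -RintegralD//; [|exact: integrable_vague..].
apply: le_Rintegral => //; first exact: integrable_vague.
  exact: (integrableD _ (integrable_vague fmu fnu) (integrable_vague fnu fla)).
move=> r _; rewrite -mulrDr ler_pM2l ?expR_gt0//.
by apply: min1D; rewrite ?prohorov_dist_ge0// prohorov_dist_triangle// truncate_fin.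
Qed.

(** If the Prohorov distance were at least [e] at every radius in []r, r + 1[], the integrand would
    be at least [e * expR (- (r + 1))] on an interval of length 1, against the hypothesis. The bound
    [e <= 1] keeps [e] under the cap of [Num.min 1]. *)
Lemma vague_dist_close mu nu r e : locally_finite mu -> locally_finite nu ->
  0 <= r -> 0 < e <= 1 -> vague_dist mu nu < e * expR (- (r + 1)) ->
  vague_close mu nu r e.
Proof.
move=> fmu fnu r0 /andP[e0 e1] h.
have [s /andP[rs _] hs] : exists2 s, r < s < r + 1 &
    prohorov_dist (truncate mu s) (truncate nu s) < e.
  apply: contrapT => /forall2NP hn; move: h; apply/negP; rewrite -leNgt.
  have hn' s : r < s < r + 1 -> e <= prohorov_dist (truncate mu s) (truncate nu s).
    by move=> rs; rewrite leNgt; apply/negP; case: (hn s).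
  rewrite -lee_fin /vague_dist /Rintegral fineK; last first.
    exact/integrable_fin_num/integrable_vague.
  have -> : (e * expR (- (r + 1)))%:E =
      (\int[lebesgue_measure]_(x in `]r, (r + 1)%R[) cst (e * expR (- (r + 1)))%:E x)%E.
    rewrite integral_cst//= lebesgue_measure_itv/= lte_fin ltrDl ltr01.
    by rewrite -EFinB addrAC subrr add0r mule1.
  have mv D : measurable D -> measurable_fun D (EFin \o vague_integrand mu nu).
    by move=> mD; apply/measurable_EFinP; exact: vague_integrand_measurable.
  apply: (@le_trans _ _
    (\int[lebesgue_measure]_(x in `]r, (r + 1)%R[) (vague_integrand mu nu x)%:E)%E).
    apply: ge0_le_integral => //.
    - by move=> x _; rewrite lee_fin mulr_ge0 ?expR_ge0// ltW.
    - exact: mv.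
    - move=> x /=; rewrite in_itv/= => /andP[rx xr]; rewrite lee_fin (mulrC e).
      apply: ler_pM; [exact: expR_ge0|exact: ltW| |].
        by rewrite ler_expR lerN2 ltW.
      by rewrite le_min e1 hn'// rx.
  apply: ge0_subset_integral => //; first exact: mv.
    by move=> x _; rewrite lee_fin vague_integrand_ge0.
  by move=> x /=; rewrite !in_itv/= andbT => /andP[+ _]; exact: le_lt_trans.
have hc := prohorov_dist_lt (truncate_fin s fmu) (truncate_fin s fnu) hs.
move=> A mA Ar; have [+ _] := hc A mA; rewrite !truncateE.
rewrite [A `&` _](_ : _ = A); last first.
  apply/setIidl => x /Ar /ball_mdistP xr; apply: sub_truncset.
  by apply/ball_mdistP; exact: lt_trans rs.
move=> /le_trans; apply; rewrite leeD2r//.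
apply: (@le_trans _ _ (nu (nbh A e))).
  apply: le_borel; [|exact: borel_nbh|].
    by apply: measurableI; [exact: borel_nbh|exact: measurable_truncset].
  exact: subIsetl.
by rewrite -[leLHS]mul1e lee_wpmul2r// lee_fin lerDl ltW.
Qed.

(** Thickening by [e < d] moves the radius by less than [d]. For the first inequality the set is
    shrunk to radius [r - d] before it is thickened, for the second its thickening may reach radius
    [r + d]; either way the error is mass of [mu] near the sphere of radius [r], less than [eta].
    Only [mu] must have a small jump there, so the exceptional radii will not depend on the sequence
    that tends to [mu]. The factor [1 + e] turns into the additive term with [trunc_mass]. *)
Lemma vague_close_prohorov mu nu r d e eta : locally_finite mu -> locally_finite nu ->
  0 < e < d -> trunc_mass mu (r + d) - trunc_mass mu (r - d) < eta ->
  vague_close mu nu (r + d + d) e -> vague_close nu mu (r + d + d) e ->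
  prohorov_close (truncate mu r) (truncate nu r)
    (e + e * trunc_mass mu (r + d) + eta).
Proof.
move=> fmu fnu /andP[e0 ed] jump h1 h2 A mA.
have d0 : 0 < d by exact: lt_trans ed.
have rd : r - d <= r by rewrite gerBl ltW.
have dr : r <= r + d by rewrite lerDl ltW.
have c0 : 0 <= trunc_mass mu (r + d) by rewrite fine_ge0.
have j0 : trunc_mass mu (r - d) <= trunc_mass mu r by exact: trunc_mass_nd.
have j1 : trunc_mass mu r <= trunc_mass mu (r + d) by exact: trunc_mass_nd.
have tE := trunc_massE (r + d) fmu.
have tlow (C : set (borel X)) : measurable C -> (mu (C `&` @truncset R X r) <=
    mu (C `&` @truncset R X (r - d)) + eta%:E)%E.
  move=> mC; apply: le_trans (truncate_le fmu mC rd) _; rewrite leeD2l// lee_fin.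
  by apply: le_trans (ltW jump); rewrite lerD2r.
have tup (C : set (borel X)) : measurable C -> (mu (C `&` @truncset R X (r + d)) <=
    mu (C `&` @truncset R X r) + eta%:E)%E.
  move=> mC; apply: le_trans (truncate_le fmu mC dr) _; rewrite leeD2l// lee_fin.
  by apply: le_trans (ltW jump); rewrite lerD2l lerN2.
have eta0 : 0 <= eta by apply: le_trans (ltW jump); rewrite subr_ge0 (le_trans j0).
move: (trunc_mass mu (r + d)) c0 tE {jump j0 j1} => c c0 tE.
set E := e + _ + _.
have ec0 : 0 <= e * c by rewrite mulr_ge0// ltW.
have eE : e <= E by rewrite /E -addrA lerDl addr_ge0.
have mS s := @measurable_truncset R X s.
have mN B s : measurable (nbh B s : set (borel X)) by exact: borel_nbh.
have mI (B : set (borel X)) s : measurable B -> measurable (B `&` @truncset R X s : set (borel X)).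
  by move=> mB; exact: measurableI.
have sub s s' : s < s' -> @truncset R X s `<=` ball (point : X) s' by exact: truncset_ball.
rewrite !truncateE; split.
- apply: (le_trans (tlow _ mA)).
  set B : set (borel X) := A `&` _.
  have mB : measurable B by exact: mI.
  have BS : B `<=` @truncset R X (r - d) by exact: subIsetr.
  have := h1 B mB; move=> /(_ _)/wrap[].
    by apply: subset_trans BS _; apply: sub; lra.
  have sN : nbh B e `<=` nbh A E `&` @truncset R X r.
    move=> x [y By xy]; split.
      by exists y; [case: By|exact: lt_le_trans eE].
    apply: sub_truncset; apply/ball_mdistP.
    have /BS/truncset_mdist py := By.
    apply: le_lt_trans (metric_triangle point y x) _.
    by rewrite (metric_sym y x); clear -py xy ed; lra.
  have le1 : (nu (nbh B e) <= nu (nbh A E `&` @truncset R X r))%E.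
    by apply: le_borel => //; exact: mI.
  have fB := locally_finite_le fmu mB BS.
  have fE := locally_finite_le fnu (mI _ _ (mN A E)) (@subIsetr _ _ (@truncset R X r)).
  have fN := locally_finite_le fnu (mN B e) (subset_trans sN (@subIsetr _ _ (@truncset R X r))).
  have leB : (mu B <= mu (@truncset R X (r + d)))%E.
    by apply: le_borel => //; apply: subset_trans BS _; apply: truncsetS; clear -d0; lra.
  move: le1 leB; rewrite fB fE fN tE.
  set z := fine _; set y := fine _; set x := fine _.
  rewrite -EFinM -!EFinD !lee_fin => zy xc h.
  (* No bound on the [nu]-mass [z] is known in advance. If [z] is at least [x] the claim is
     immediate, and otherwise [z] is bounded by [c] through [x]. *)
  have [xz|zx] := leP x z.
    by rewrite /E; clear -eta0 e0 xz zy ec0; lra.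
  have : e * z <= e * c by rewrite ler_pM2l// (le_trans (ltW zx)).
  by rewrite mulrDl mul1r in h; rewrite /E; clear -eta0 e0 h zy ec0; lra.
- set B : set (borel X) := A `&` _.
  have mB : measurable B by exact: mI.
  have BS : B `<=` @truncset R X r by exact: subIsetr.
  have := h2 B mB; move=> /(_ _)/wrap[].
    by apply: subset_trans BS _; apply: sub; lra.
  have sN : nbh B e `<=` nbh A E `&` @truncset R X (r + d).
    move=> x [y By xy]; split.
      by exists y; [case: By|exact: lt_le_trans eE].
    apply: sub_truncset; apply/ball_mdistP.
    have /BS/truncset_mdist py := By.
    apply: le_lt_trans (metric_triangle point y x) _.
    by rewrite (metric_sym y x); clear -py xy ed; lra.
  have le1 : (mu (nbh B e) <= mu (nbh A E `&` @truncset R X (r + d)))%E.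
    by apply: le_borel => //; exact: mI.
  have le2 := tup _ (mN A E).
  have fB := locally_finite_le fnu mB BS.
  have fE := locally_finite_le fmu (mI _ _ (mN A E)) (@subIsetr _ _ (@truncset R X (r + d))).
  have fE' := locally_finite_le fmu (mI _ _ (mN A E)) (@subIsetr _ _ (@truncset R X r)).
  have fN := locally_finite_le fmu (mN B e)
    (subset_trans sN (@subIsetr _ _ (@truncset R X (r + d)))).
  have leB : (mu (nbh B e) <= mu (@truncset R X (r + d)))%E.
    by apply: le_borel => //; apply: subset_trans sN _; exact: subIsetr.
  move: le1 le2 leB; rewrite fB fE fN fE' tE.
  set x := fine _; set y := fine _; set z := fine _; set w := fine _.
  rewrite -EFinM -!EFinD !lee_fin => xy yz xc h.
  have : e * x <= e * c by rewrite ler_pM2l.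
  by rewrite mulrDl mul1r in h; rewrite /E; clear -eta0 e0 h xy yz ec0; lra.
Qed.

Lemma vague_dist_cvg mu (nu_ : nat -> {measure set (borel X) -> \bar R}) :
  locally_finite mu -> (forall n, locally_finite (nu_ n)) ->
  (forall r e, 0 < e -> \forall n \near \oo,
     vague_close mu (nu_ n) r e /\ vague_close (nu_ n) mu r e) ->
  vague_dist mu (nu_ n) @[n --> \oo] --> 0.
Proof.
move=> fmu fnu h.
have ptw r : (forall e, 0 < e -> exists2 d, 0 < d &
      trunc_mass mu (r + d) - trunc_mass mu (r - d) < e) ->
    vague_integrand mu (nu_ n) r @[n --> \oo] --> 0.
  move=> hr.
  suff cvp : prohorov_dist (truncate mu r) (truncate (nu_ n) r) @[n --> \oo] --> 0.
    rewrite -(mulr0 (expR (- r))); apply: cvgM; first exact: cvg_cst.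
    apply: (@squeeze_cvgr _ _ _ _ (fun=> 0) (fun n =>
      prohorov_dist (truncate mu r) (truncate (nu_ n) r))) => //; last exact: cvg_cst.
    apply: nearW => n; rewrite le_min ler01 prohorov_dist_ge0 ge_min lexx orbT//.
  apply/cvgrPdist_le => eta eta0.
  have eta20 : 0 < eta / 2 by rewrite divr_gt0.
  have [d d0 hd] := hr _ eta20.
  set c := trunc_mass mu (r + d); have c0 : 0 <= c by rewrite fine_ge0.
  (* This makes [e + e * c] at most [eta / 2]; the other half of [eta] pays for the jump at [r]. *)
  pose e := Num.min (d / 2) (eta / 2 / (1 + c)).
  have e0 : 0 < e by rewrite lt_min !divr_gt0//; lra.
  have ed : e < d by rewrite (@le_lt_trans _ _ (d / 2)) ?ge_min ?lexx//; lra.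
  have ec : e + e * c <= eta / 2.
    by rewrite -{1}(mulr1 e) -mulrDr -ler_pdivlMr ?ge_min ?lexx ?orbT//; lra.
  near=> n.
  rewrite sub0r normrN ger0_norm ?prohorov_dist_ge0//.
  have [h1 h2] : vague_close mu (nu_ n) (r + d + d) e /\ vague_close (nu_ n) mu (r + d + d) e.
    by near: n; exact: h.
  apply: (@le_trans _ _ (e + e * c + eta / 2)); last lra.
  apply: prohorov_dist_le.
    by have := mulr_ge0 (ltW e0) c0; lra.
  by apply: vague_close_prohorov => //; rewrite e0.
have cJ := nondecreasing_jumps (trunc_mass_nd fmu).
set J := (X in countable X) in cJ.
have H1 n : measurable_fun (`]0%R, +oo[%classic : set (measurableTypeR R))
    (EFin \o vague_integrand mu (nu_ n)).
  by apply/measurable_EFinP; exact: vague_integrand_measurable.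
have H2 : {ae lebesgue_measure, forall r : R, `]0%R, +oo[%classic r ->
    (EFin \o vague_integrand mu (nu_ n)) r @[n --> \oo] --> cst 0%E r}.
  exists J; split.
  - exact: countable_measurable.
  - exact: countable_lebesgue_measure0.
  - move=> r /= nr; apply: contra_notP nr => /contrapT Jr _.
    by apply: cvg_EFin; [exact: nearW|exact: ptw].
have H3 : {ae lebesgue_measure, forall (r : R) n, `]0%R, +oo[%classic r ->
    (`|(EFin \o vague_integrand mu (nu_ n)) r| <= (EFin \o (fun r : R => expR (- r))) r)%E}.
  apply: aeW => r n _; rewrite /= lee_fin ger0_norm ?vague_integrand_ge0//.
  exact: vague_integrand_le.
have [_ _] := @dominated_convergence _ _ _ (@lebesgue_measure R) `]0%R, +oo[
  (measurable_itv _) (fun n => EFin \o vague_integrand mu (nu_ n)) (cst 0%E) _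
  H1 (measurable_cst _) H2 integrable_expRN H3.
rewrite integral0 => /fine_cvg; apply: cvg_trans.
by apply: near_eq_cvg; apply: nearW.
Unshelve. all: by end_near. Qed.

End vague.

(** * Measures at vague distance zero *)

Section vague_separation.
Context {R : realType} {X : rootedMetricType R}.
Implicit Types (mu nu : {measure set (borel X) -> \bar R}) (e r : R).

Lemma closed_mdist_le (x : X) r : closed [set y | mdist x y <= r].
Proof.
rewrite -[X in closed X]setCK; apply: open_closedC; apply: mdist_open => y /= /negP.
rewrite -ltNge => ry; exists (mdist x y - r); first by rewrite subr_gt0.
move=> z yz; apply/negP; rewrite -ltNge.
have := metric_triangle x z y; rewrite (metric_sym z y); clear -yz; lra.
Qed.

Lemma nbh_bigcap (A : set X) : closed A -> \bigcap_n nbh A n.+1%:R^-1 = A.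
Proof.
move=> cA; apply/seteqP; split; last by move=> x Ax n _; apply: sub_nbh.
move=> x nx; apply: cA => B /nbhs_ballP[e /= e0 eB].
have [n ne] : exists n, n.+1%:R^-1 < e.
  exists (Num.truncn e^-1); rewrite invf_plt ?posrE//; exact: truncnS_gt.
have [y Ay xy] := nx n I; exists y; split => //; apply: eB.
by apply/ball_mdistP; exact: lt_trans ne.
Qed.

(** Let [e] tend to 0: the neighbourhoods of a closed set decrease to it, and their [nu]-masses
    converge because they all lie within radius [r + 1], where [nu] is finite. *)
Lemma vague_close_le mu nu r (A : set X) : locally_finite nu ->
  (forall r e, 0 < e -> vague_close mu nu r e) -> closed A ->
  A `<=` ball (point : X) r -> (mu A <= nu A)%E.
Proof.
move=> fnu h cA Ar.
have mA : measurable (A : set (borel X)) by exact: borel_closed.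
have mN e : measurable (nbh A e : set (borel X)) by exact: borel_nbh.
pose d n : R := n.+1%:R^-1.
have sub n : nbh A (d n) `<=` @truncset R X (r + 1).
  apply: subset_trans (@sub_truncset _ _ _) ; apply: subset_trans (@nbh_ball _ _ _ _ _).
  by apply: nbhS => //; rewrite /d invf_le1// ler1n.
have fN n := locally_finite_le fnu (mN (d n)) (@sub n).
have fA : nu A = (fine (nu A))%:E.
  by apply: (@locally_finite_le _ _ _ r) => //; apply: subset_trans Ar _; exact: sub_truncset.
have cvN : fine (nu (nbh A (d n))) @[n --> \oo] --> fine (nu A).
  apply: fine_cvg; rewrite -fA -{2}(nbh_bigcap cA).
  apply: nonincreasing_cvg_mu => //.
  - by rewrite fN ltry.
  - by rewrite nbh_bigcap.
  - move=> m n mn; apply/subsetPset; apply: nbhS => //.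
    by rewrite lef_pV2 ?posrE// ler_nat.
have cvd : d n @[n --> \oo] --> 0 by exact: cvg_harmonic.
have hA n : (mu A <= ((1 + d n) * fine (nu (nbh A (d n))) + d n)%:E)%E.
  have dn0 : 0 < d n by rewrite /d invr_gt0 ltr0n.
  by rewrite EFinD EFinM -fN; exact: (h r (d n) dn0 A mA Ar).
have fmuA : mu A = (fine (mu A))%:E.
  by rewrite fineK// ge0_fin_numE// (le_lt_trans (hA 0%N)) ?ltry.
rewrite fmuA fA lee_fin.
have : (1 + d n) * fine (nu (nbh A (d n))) + d n @[n --> \oo] --> (1 + 0) * fine (nu A) + 0.
  by apply: cvgD => //; apply: cvgM => //; apply: cvgD => //; exact: cvg_cst.
rewrite !addr0 mul1r => cv.
apply: (cvgr_to_ge cv); apply: nearW => n.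
by rewrite -lee_fin -fmuA.
Qed.

(** Bounded closed sets are stable under intersection and are the sets on which vague closeness
    compares masses, so uniqueness of measures can be applied to them. A closed set is the countable
    union of its traces on closed balls around the root. *)
Lemma borel_generated_bounded :
  @measurable _ (borel X) =
  <<s [set A : set X | closed A /\ exists r, A `<=` ball (point : X) r] >>.
Proof.
set G := [set A : set X | _]; apply/seteqP; split; last first.
  apply: smallest_sub; first exact: sigma_algebra_measurable.
  by move=> A [cA _]; exact: borel_closed.
apply: smallest_sub; first exact: smallest_sigma_algebra.
move=> U oU; rewrite -[U]setCK.
have -> : ~` U = \bigcup_n (~` U `&` [set y | mdist (point : X) y <= n%:R]).
  apply/seteqP; split=> [x nUx|x [n _ []//]].
  exists (Num.truncn (mdist point x)).+1 => //; split => //=; exact/ltW/truncnS_gt.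
have sG : sigma_algebra setT <<s G >> by exact: smallest_sigma_algebra.
have [_ sC sU] := sG.
rewrite -setTD; apply: sC; apply: sU => n; apply: sub_sigma_algebra; split.
  by apply: closedI; [exact: open_closedC|exact: closed_mdist_le].
exists (n%:R + 1) => x [_ /= xn]; apply/ball_mdistP; rewrite (le_lt_trans xn)// ltrDl//.
Qed.

Lemma vague_dist_eq0 mu nu : locally_finite mu -> locally_finite nu ->
  vague_dist mu nu = 0 ->
  forall A : set (borel X), measurable A -> mu A = nu A.
Proof.
move=> fmu fnu mn0.
have cl mu' nu' : locally_finite mu' -> locally_finite nu' -> vague_dist mu' nu' = 0 ->
    forall r e, 0 < e -> vague_close mu' nu' r e.
  move=> f f' d0 r e e0 A mA Ar.
  pose d := Num.min e 1; have d0' : 0 < d by rewrite lt_min e0 ltr01.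
  have de : d <= e by rewrite ge_min lexx.
  have d01 : 0 < d <= 1 by rewrite d0' ge_min lexx orbT.
  have hd : vague_dist mu' nu' < d * expR (- (`|r| + 1)).
    by rewrite d0 mulr_gt0 ?expR_gt0.
  have := vague_dist_close f f' (normr_ge0 r) d01 hd mA; move=> /(_ _)/wrap[].
    by move=> x /Ar/ball_mdistP xr; apply/ball_mdistP/(lt_le_trans xr); exact: ler_norm.
  move=> /le_trans; apply; apply: leeD; last by rewrite lee_fin.
  apply: lee_pmul => //; first by rewrite lee_fin; clear -d0'; lra.
    by rewrite lee_fin lerD2l.
  by apply: le_borel; [exact: borel_nbh..|exact: nbhS].
have c1 := cl _ _ fmu fnu mn0.
have c2 := cl _ _ fnu fmu (etrans (vague_distC _ _) mn0).
have ball_n n : [set y | mdist (point : X) y <= n%:R] `<=` ball (point : X) (n%:R + 1).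
  by move=> x /= xn; apply/ball_mdistP; rewrite (le_lt_trans xn)// ltrDl.
apply: (@measure_unique _ R (borel X)
  [set A : set X | closed A /\ exists r, A `<=` ball (point : X) r]
  (fun n => [set y | mdist (point : X) y <= n%:R]) borel_generated_bounded).
- move=> A B [cA [r Ar]] [cB _]; split; first exact: closedI.
  by exists r; apply: subset_trans Ar; exact: subIsetl.
- by move=> n; split; [exact: closed_mdist_le|exists (n%:R + 1)].
- apply/seteqP; split => // x _; exists (Num.truncn (mdist point x)).+1 => //=.
  exact/ltW/truncnS_gt.
- move=> A [cA [r Ar]]; apply/eqP; rewrite eq_le.
  by rewrite (vague_close_le fnu c1 cA Ar) (vague_close_le fmu c2 cA Ar).
- move=> n; apply: le_lt_trans (fmu (n%:R + 1)).
  apply: le_borel; [apply: (@borel_closed R X); exact: closed_mdist_le|exact: measurable_truncset|].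
  by apply: subset_trans (ball_n n) _; exact: sub_truncset.
Qed.

Lemma radon_measure_eq (mu nu : radon_measure X) :
  (forall A : set (borel X), measurable A -> mu A = nu A) -> mu = nu.
Proof.
case: mu nu => [mu kmu omu] [nu knu onu] /= h.
suff E : mu = nu by subst nu; congr RadonMeasure; exact: Prop_irrelevance.
apply: eq_measure; apply/funext => A; rewrite omu onu /mu_ext; congr ereal_inf.
apply/seteqP; split => _ [F mF <-]; exists F => //; apply: eq_eseriesr => k _.
  by rewrite h//; case: mF.
by rewrite h//; case: mF.
Qed.

Lemma radon_locally_finite (mu : radon_measure X) : boundedly_compact X ->
  locally_finite mu.
Proof.
case: mu => mu kmu omu /= bc r; apply: kmu.
apply: (subclosed_compact _ (bc point r)); first exact: closed_closure.
by move=> x /truncset_mdist.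
Qed.

End vague_separation.

(** * Metrization by locally controlled Cauchy sequences *)

Section complete_metrization.
Context {R : realType} {T : Type} (d : T -> T -> R).
Hypothesis dm : is_metric d.
Variable Q : nat -> set T -> Prop.
Hypothesis QS : forall k (U V : set T), U `<=` V -> Q k V -> Q k U.
Hypothesis Qloc : forall k x, exists2 e : R, 0 < e & Q k [set y | d x y < e].

(** The bound [e <= 1] keeps the supremum finite even when [Q k] holds of every ball. *)
Let gauge_set k x : set R := [set e | [/\ 0 < e, e <= 1 & Q k [set y | d x y < e]]].
Let gauge k x : R := sup (gauge_set k x).

Let dxx x : d x x = 0. Proof. by case: dm. Qed.
Let dC x y : d x y = d y x. Proof. by case: dm. Qed.
Let dtri x y z : d x z <= d x y + d y z. Proof. by case: dm. Qed.
Let d_ge0 x y : 0 <= d x y.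
Proof. by have := dtri x y x; rewrite dxx (dC y x); lra. Qed.

Let gauge_sup k x : has_sup (gauge_set k x).
Proof.
split; last by exists 1 => e [].
have [e e0 Qe] := Qloc k x; exists (Num.min e 1); split.
- by rewrite lt_min e0 ltr01.
- by rewrite ge_min lexx orbT.
- by apply: QS Qe => y /=; rewrite lt_min => /andP[].
Qed.

Let gauge_gt0 k x : 0 < gauge k x.
Proof.
have [[e ge] _] := gauge_sup k x; have [e0 _ _] := ge.
by apply: lt_le_trans e0 _; apply: ub_le_sup ge; case: (gauge_sup k x).
Qed.

Let gauge_lip k x y : gauge k x <= gauge k y + d x y.
Proof.
apply: ge_sup; first by case: (gauge_sup k x).
move=> e [e0 e1 Qe]; rewrite leNgt; apply/negP => h.
have gy0 := gauge_gt0 k y.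
have : gauge_set k y (e - d x y).
  split; [by lra|by have := d_ge0 x y; lra|].
  apply: QS Qe => z /= yz; apply: le_lt_trans (dtri x y z) _; lra.
move=> /(ub_le_sup (gauge_sup k y).2); rewrite -/(gauge k y).
lra.
Qed.

Let gdiff k x y := `|(gauge k x)^-1 - (gauge k y)^-1|.

(** The cap tends to 0 with [k], so the supremum of all terms is small as soon as finitely many of
    them are. Since each [gdiff k x] is continuous at [x], adding the supremum to [d] does not
    change the topology. *)
Let gterm x y k := Num.min (k.+1%:R^-1) (gdiff k x y).

Let dg x y := sup (range (gterm x y)).

Let gterm_ge0 x y k : 0 <= gterm x y k.
Proof. by rewrite le_min invr_ge0 ler0n normr_ge0. Qed.

Let dg_sup x y : has_sup (range (gterm x y)).
Proof.
split; first by exists (gterm x y 0%N); exists 0%N.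
exists 1 => _ [k _ <-]; rewrite ge_min invf_le1// ler1n//.
Qed.

Let gterm_le x y k : gterm x y k <= dg x y.
Proof. by apply: ub_le_sup; [case: (dg_sup x y)|exists k]. Qed.

Let dg_ge0 x y : 0 <= dg x y.
Proof. exact: le_trans (gterm_ge0 x y 0) (gterm_le x y 0). Qed.

Let dg_le x y a : (forall k, gterm x y k <= a) -> dg x y <= a.
Proof. by move=> h; apply: ge_sup => [|_ [k _ <-]//]; case: (dg_sup x y). Qed.

Let D x y := d x y + dg x y.

Let D_metric : is_metric D.
Proof.
split.
- move=> x; rewrite /D dxx add0r; apply/eqP; rewrite eq_le dg_ge0 andbT; apply: dg_le => k.
  by rewrite /gterm /gdiff subrr normr0 ge_min lexx orbT.
- move=> x y xy; have [_ d0 _ _] := dm; apply: d0.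
  by have := dg_ge0 x y; have := d_ge0 x y; move: xy; rewrite /D; lra.
- move=> x y; have E : gterm x y = gterm y x.
    by apply/funext => k; rewrite /gterm /gdiff distrC.
  by rewrite /D /dg dC E.
- move=> x y z; rewrite /D addrACA; apply: lerD => //; apply: dg_le => k.
  apply: le_trans (lerD (gterm_le x y k) (gterm_le y z k)).
  have : gdiff k x z <= gdiff k x y + gdiff k y z by rewrite /gdiff ler_distD.
  have : 0 <= gdiff k x y by rewrite /gdiff normr_ge0.
  have : 0 <= gdiff k y z by rewrite /gdiff normr_ge0.
  have : (0 : R) < k.+1%:R^-1 by [].
  rewrite /gterm; move: (gdiff _ _ _) (gdiff _ _ _) (gdiff _ _ _) (_^-1) => a b c t.
  by rewrite !minEle; case: ifPn => ?; case: ifPn => ?; case: ifPn => ?; lra.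
Qed.

Let gauge_inv_cont k x e : 0 < e ->
  exists2 a, 0 < a & forall y, d x y < a -> gdiff k x y < e.
Proof.
move=> e0; have g0 := gauge_gt0 k x.
set g := gauge k x in g0 *.
exists (Num.min (g / 2) (e * (g * (g / 2)))).
  by rewrite lt_min !mulr_gt0// invr_gt0.
move=> y; rewrite lt_min => /andP[xy1 xy2].
have h1 := gauge_lip k x y; have h2 := gauge_lip k y x.
rewrite dC in h2; rewrite /gdiff -/g.
have gy0 := gauge_gt0 k y; move: h1 h2 gy0; rewrite -/g; move: (gauge k y) => h h1 h2 h0.
have hg : g / 2 < h by lra.
have -> : g^-1 - h^-1 = (h - g) / (g * h) by field; rewrite !gt_eqF.
rewrite normrM normfV [X in _ / X]gtr0_norm ?mulr_gt0// ltr_pdivrMr ?mulr_gt0//.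
have hd : `|h - g| <= d x y by rewrite ler_norml; lra.
apply: le_lt_trans hd _; apply: lt_trans xy2 _.
by rewrite !ltr_pM2l.
Qed.

Let D_open : metric_open d = metric_open D.
Proof.
apply/seteqP; split => U oU x /oU[e e0 eU].
  exists e => // y /= xy; apply: eU => /=; apply: le_lt_trans xy.
  by rewrite /D lerDl.
have e20 : 0 < e / 2 by rewrite divr_gt0.
have [N hN] : exists N, forall k, (N <= k)%N -> (k.+1%:R^-1 : R) <= e / 4.
  exists (Num.truncn (e / 4)^-1) => k Nk.
  rewrite invf_ple ?posrE ?divr_gt0//; apply/ltW/(lt_le_trans (truncnS_gt _)).
  by rewrite ler_nat.
have [a a0 ha] : exists2 a, 0 < a &
    forall k, (k < N)%N -> forall y, d x y < a -> gdiff k x y <= e / 4.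
  clear hN; elim: N => [|N [a a0 ha]]; first by exists 1.
  have e40 : 0 < e / 4 by rewrite divr_gt0.
  have [b b0 hb] := gauge_inv_cont N x e40.
  exists (Num.min a b); first by rewrite lt_min a0.
  move=> k; rewrite ltnS leq_eqVlt => /predU1P[->|kN] y; rewrite lt_min => /andP[ya yb].
    exact/ltW/hb.
  exact: ha.
exists (Num.min a (e / 2)); first by rewrite lt_min a0.
move=> y /=; rewrite lt_min => /andP[ya ye]; apply: eU => /=.
have : dg x y <= e / 4.
  apply: dg_le => k; rewrite /gterm ge_min.
  by case: (ltnP k N) => kN; [rewrite ha ?orbT|rewrite hN].
by move: ye; rewrite /D; lra.
Qed.

(* Cech's criterion: the completing metric adds to [d] the terms
   [|1 / gauge k x - 1 / gauge k y|], where [gauge k x] is the largest radius (up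
   to [1]) of a ball around [x] satisfying [Q k]. *)
Lemma complete_metrization :
  (forall u : nat -> T,
     (forall e : R, 0 < e -> \forall m & n \near \oo, d (u m) (u n) < e) ->
     (forall k, exists N, Q k [set u n | n in [set n | (N <= n)%N]]) ->
     exists l : T, d (u n) l @[n --> \oo] --> (0 : R)) ->
  exists D : T -> T -> R,
    [/\ is_metric D, complete_metric D & metric_open d = metric_open D].
Proof.
move=> hu; exists D; split => // u uD.
have ud e : 0 < e -> \forall m & n \near \oo, d (u m) (u n) < e.
  move=> /uD; apply: filterS => -[m n] /=; apply: le_lt_trans.
  by rewrite /D lerDl.
have [|l ul] := hu u ud.
  (* A distance below half the cap forces the minimum in [gterm] to be [gdiff] itself. Hence
     [1 / gauge k] stays bounded along the tail and [gauge k] stays above some [g > 0]. A later tail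
     of [d]-diameter less than [g] then lies in a ball that satisfies [Q k]. *)
  move=> k; have /uD : (0 : R) < k.+1%:R^-1 / 2 by [].
  move=> [[/= A B] [[N1 _ hA] [N2 _ hB]] hAB].
  pose M := maxn N1 N2.
  have AM : A M by apply: hA; exact: leq_maxl.
  have bnd n : (M <= n)%N -> (gauge k (u n))^-1 < (gauge k (u M))^-1 + 1.
    move=> Mn; have Bn : B n by apply: hB; rewrite /= (leq_trans (leq_maxr N1 _)).
    have := hAB (M, n) (conj AM Bn); rewrite /= /D => h.
    have : gterm (u M) (u n) k < k.+1%:R^-1 / 2.
      by apply: le_lt_trans h; rewrite (le_trans (gterm_le _ _ _))// lerDr.
    rewrite /gterm gt_min => /orP[|].
      rewrite ltNge ler_pdivrMr// ler_peMr ?invr_ge0//.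
      by rewrite ler1n.
    rewrite /gdiff ltr_norml => /andP[h1 _].
    have k1 : (k.+1%:R^-1 : R) <= 1 by rewrite invf_le1// ler1n.
    move: h1 k1; move: (k.+1%:R^-1) (gauge k (u M))^-1 (gauge k (u n))^-1 => a b c h1 k1; lra.
  pose g := ((gauge k (u M))^-1 + 1)^-1.
  have g0 : 0 < g by rewrite invr_gt0 addr_gt0// invr_gt0.
  have glow n : (M <= n)%N -> g < gauge k (u n).
    move=> Mn; rewrite /g invf_plt ?posrE ?addr_gt0 ?invr_gt0//; exact: bnd.
  have [[/= A' B'] [[N1' _ hA'] [N2' _ hB']] hAB'] := ud g g0.
  pose N := maxn M (maxn N1' N2').
  have MN : (M <= N)%N by exact: leq_maxl.
  exists N.
  have gN := glow N MN.
  have [e [e0 e1 Qe] ge] := sup_gt (gauge_sup k (u N)).1 gN.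
  apply: QS Qe => _ [n /= Nn <-]; apply: lt_trans ge.
  apply: (hAB' (N, n)); split => /=.
    by apply: hA'; rewrite /= (leq_trans (leq_maxl N1' N2'))// leq_maxr.
  by apply: hB'; rewrite /= (leq_trans (leq_maxr N1' N2'))// (leq_trans _ Nn)// leq_maxr.
(* Convergence for [d] passes to [D] because the [D]-ball around [l] is open for [d] as well. *)
exists l; apply/cvgrPdist_lt => e e0.
have [D0 _ DC Dtri] := D_metric.
have oB : metric_open D [set y | D l y < e].
  move=> y /= ly; exists (e - D l y); first by rewrite subr_gt0.
  by move=> z /=; have := Dtri l y z; lra.
rewrite -D_open in oB; have [|a a0 ha] := oB l; first by rewrite /= D0.
have /cvgrPdist_lt/(_ _ a0) := ul; apply: filterS => n.
rewrite !sub0r !normrN ger0_norm// => ln.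
by rewrite ger0_norm ?addr_ge0// DC; apply: ha => /=; rewrite dC.
Qed.

End complete_metrization.

(** * Discrete measures as sets of weighted atoms *)

Lemma esum_subset {R : realType} {T : choiceType} (A B : set T) (f : T -> \bar R) : A `<=` B ->
  (\esum_(x in A) f x <= \esum_(x in B) f x)%E.
Proof.
move=> AB; apply: ge_ereal_sup => _ [F [finF FA] <-].
by apply: ereal_sup_ubound; exists F => //; split => //; exact: subset_trans AB.
Qed.

Section esum_transfer.
Context {R : realType} {T T' : choiceType}.
Local Open Scope ereal_scope.

(** [t] is meant as a matching of atoms and [c] as a bound on the ratio of their weights. On a
    finite subset the sum is compared with the sum over its injective image. *)
Lemma esum_transfer (A : set T) (B : set T') (t : T -> T') (f : T -> \bar R)
    (g : T' -> \bar R) (c : R) : (0 <= c)%R -> (forall x, 0 <= g x) ->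
  set_inj A t -> (forall x, A x -> B (t x)) -> (forall x, A x -> f x <= c%:E * g (t x)) ->
  \esum_(x in A) f x <= c%:E * \esum_(x in B) g x.
Proof.
move=> c0 g0 tinj AB fg; apply: ge_ereal_sup => _ [F [finF FA] <-].
apply: (@le_trans _ _ (\sum_(x \in F) (c%:E * g (t x)))).
  by apply: lee_fsum => // x /FA; exact: fg.
rewrite -ge0_mule_fsumr; last by move=> x; exact: g0.
rewrite lee_wpmul2l ?lee_fin// -esum_fset// -(esum_image F t g); last first.
  by move=> x y; rewrite !inE => /FA Ax /FA Ay; apply: tinj; rewrite inE.
by apply: esum_subset => _ [x /FA/AB Bx <-].
Qed.

End esum_transfer.

Section outer_radon.
Context {R : realType} {X : rootedMetricType R}.
Variable mu : {measure set (borel X) -> \bar R}.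

(* The value imposed on non-Borel sets by [radon_measure]. *)
Definition outer_value (A : set (borel X)) : \bar R := (mu^* A)%mu.

Let outer_value0 : outer_value set0 = 0%E. Proof. exact: mu_ext0. Qed.

Let outer_value_ge0 A : (0 <= outer_value A)%E. Proof. exact: mu_ext_ge0. Qed.

Let outer_value_sigma_additive : semi_sigma_additive outer_value.
Proof.
move=> F mF tF mUF; rewrite /outer_value (measurable_mu_extE _ mUF).
under eq_fun do under eq_bigr do rewrite (measurable_mu_extE _ (mF _)).
exact: measure_semi_sigma_additive.
Qed.

HB.instance Definition _ := isMeasure.Build _ _ _ outer_value
  outer_value0 outer_value_ge0 outer_value_sigma_additive.

Lemma outer_value_idem A : outer_value A = (outer_value^* A)%mu.
Proof.
rewrite {1}/outer_value /mu_ext; congr ereal_inf.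
apply/seteqP; split => _ [F mF <-]; exists F => //; apply: eq_eseriesr => k _.
  by rewrite /outer_value measurable_mu_extE//; case: mF.
by rewrite /outer_value measurable_mu_extE//; case: mF.
Qed.

Lemma radon_extension : (forall K : set X, compact K -> (mu K < +oo)%E) ->
  exists nu : radon_measure X, forall A : set (borel X), measurable A -> nu A = mu A.
Proof.
move=> h.
have fin (K : set X) : compact K -> (outer_value K < +oo)%E.
  move=> cK; rewrite /outer_value measurable_mu_extE; first exact: h.
  by apply: borel_closed; apply: compact_closed cK; exact: metric_hausdorff.
by exists (RadonMeasure fin outer_value_idem) => A mA; exact: measurable_mu_extE.
Qed.

Lemma compact_bounded_mdist (K : set X) : compact K ->
  exists r : R, K `<=` ball (point : X) r.
Proof.
rewrite compact_cover => /(_ nat setT (fun n => ball (point : X) n%:R)) [].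
- move=> n _; apply: mdist_open => y /ball_mdistP py.
  exists (n%:R - mdist point y); first by rewrite subr_gt0.
  by move=> z yz; apply/ball_mdistP; have := metric_triangle point y z; lra.
- move=> x _; exists (Num.truncn (mdist point x)).+1 => //.
  by apply/ball_mdistP; exact: truncnS_gt.
move=> F _ KF; exists (\max_(i <- F) i)%N%:R => x /KF [n /= nF /ball_mdistP xn].
apply/ball_mdistP/(lt_le_trans xn); rewrite ler_nat.
by rewrite (big_rem n) ?leq_maxl.
Qed.

End outer_radon.

Section atoms.
Context {R : realType} {S : rootedMetricType R}.
Local Notation Z := (S * posreal R)%type.
Implicit Types (z : Z) (D : set Z) (nu : discrete_measure S).

Definition wt z : R := (z.2 : {posnum R})%:num.

Definition wt_nonneg z : {nonneg R} := (z.2 : {posnum R})%:num%:nng.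

Lemma wt_gt0 z : 0 < wt z. Proof. by rewrite /wt. Qed.

Lemma eq_atom z z' : z.1 = z'.1 -> wt z = wt z' -> z = z'.
Proof.
case: z z' => [x w] [x' w'] /= -> /= ww; congr pair; apply/val_inj; exact: ww.
Qed.

Lemma dirac_sumE (X : rootedMetricType R) (I : set nat) (c : nat -> {nonneg R})
    (x : nat -> borel X) (A : set (borel X)) :
  dirac_sum I c x A = \esum_(i in I `&` x @^-1` A) (c i)%:num%:E.
Proof.
rewrite esum_mkcond /dirac_sum /mseries /= -nneseries_esumT; last first.
  by move=> n; case: ifP => // _; rewrite lee_fin.
apply: eq_eseriesr => i _; case: ifPn => Ii.
  transitivity ((c i)%:num%:E * (\d_(x i) A : \bar R))%E; first by [].
  have E : (i \in x @^-1` A) = (x i \in A) by [].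
  by rewrite diracE in_setI Ii E /=; case: ifP => _; rewrite ?mule1 ?mule0.
by rewrite in_setI (negbTE Ii).
Qed.

Definition atoms_set (a : @atoms R S) : set Z :=
  [set (atom_pos a i, atom_wt a i) | i in atom_idx a].

Lemma dirac_sum_atoms (a : @atoms R S) (X : rootedMetricType R) (f : Z -> borel X)
    (g : Z -> {nonneg R}) (A : set (borel X)) :
  dirac_sum (atom_idx a) (fun i => g (atom_pos a i, atom_wt a i))
    (fun i => f (atom_pos a i, atom_wt a i)) A =
  \esum_(z in atoms_set a `&` f @^-1` A) (g z)%:num%:E.
Proof.
rewrite dirac_sumE.
rewrite -(esum_image _ (fun i => (atom_pos a i, atom_wt a i)) (fun z => (g z)%:num%:E)).
  congr (esum _ _); apply/seteqP; split => [_ [i [Ii Ai] <-]|z [[i Ii <-] Ai]].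
    by split => //; exists i.
  by exists i.
move=> i j; rewrite !inE => -[Ii _] [Ij _] [ij _].
by apply: (atom_inj (a := a)); rewrite ?inE.
Qed.

(** The atoms are read off the masses of singletons, so no enumeration has to be chosen; weights in
    [posreal R] are positive, which excludes points without mass. *)
Definition atomset nu : set Z := [set z | nu [set z.1] = (wt z)%:E].

Lemma atomset_inj nu z z' : atomset nu z -> atomset nu z' -> z.1 = z'.1 -> z = z'.
Proof.
move=> nz nz' zz; apply: eq_atom => //; apply/eqP; rewrite -eqe.
by rewrite -nz -nz' zz.
Qed.

Lemma atoms_of_measureE (nu : radon_measure S) (a : @atoms R S) (A : set (borel S)) :
  atoms_of nu a -> measurable A ->
  nu A = \esum_(z in atoms_set a `&` fst @^-1` A) (wt z)%:E.
Proof.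
by move=> na mA; rewrite na// (dirac_sum_atoms a fst wt_nonneg).
Qed.

Lemma atoms_of_atomset nu (a : @atoms R S) : atoms_of nu a -> atomset nu = atoms_set a.
Proof.
move=> na.
have E z : atoms_set a z -> nu [set z.1] = (wt z)%:E.
  move=> [i Ii <-]; rewrite (atoms_of_measureE na); last exact: borel_set1.
  rewrite [X in esum X _](_ : _ = [set (atom_pos a i, atom_wt a i)]).
    by rewrite esum_set1// lee_fin ltW// wt_gt0.
  apply/seteqP; split => [_ [[j Ij <-] /= ji]|_ ->].
    by rewrite (_ : j = i)//; apply: (atom_inj (a := a)); rewrite ?inE.
  by split => //; exists i.
apply/seteqP; split => [z /= nz|]; last exact: E.
have [z' [az' zz']] : exists z', atoms_set a z' /\ z'.1 = z.1.
  apply: contrapT => nex; have := wt_gt0 z; rewrite -lte_fin -nz.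
  rewrite (atoms_of_measureE na); last exact: borel_set1.
  rewrite (_ : _ `&` _ = set0) ?esum_set0 ?ltxx//.
  by rewrite -subset0 => z' [az' zz']; apply: nex; exists z'.
rewrite (_ : z = z')//; apply: eq_atom => //; apply/eqP.
by rewrite -eqe -nz -(E z')// zz'.
Qed.

Lemma discreteE nu (A : set (borel S)) : measurable A ->
  nu A = \esum_(z in atomset nu `&` fst @^-1` A) (wt z)%:E.
Proof.
move=> mA; have [a na] := discrete_atoms nu.
by rewrite (atoms_of_atomset na) (atoms_of_measureE na).
Qed.

(** This frees the point process from the enumeration that [cid] selects in its definition. *)
Lemma point_processE nu (B : set (borel Z)) :
  point_process nu B = \esum_(z in atomset nu `&` B) 1%E.
Proof.
rewrite (atoms_of_atomset (svalP (cid (discrete_atoms nu)))).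
by rewrite -(dirac_sum_atoms _ (fun z => z : borel Z) (fun=> 1%:nng)).
Qed.

Lemma discrete_measure_eq nu nu' :
  (forall A : set (borel S), measurable A -> nu A = nu' A) -> nu = nu'.
Proof.
case: nu nu' => [nu na] [nu' na'] /= h.
have E : nu = nu' by exact: radon_measure_eq.
by subst nu'; congr DiscreteMeasure; exact: Prop_irrelevance.
Qed.

Lemma exists_discrete_measure D : countable D ->
  (forall z z', D z -> D z' -> z.1 = z'.1 -> z = z') ->
  (forall r, (\esum_(z in D `&` fst @^-1` ball (point : S) r) (wt z)%:E < +oo)%E) ->
  exists nu, atomset nu = D.
Proof.
move=> /countable_injP[f finj] Dinj Dfin.
(* [g] inverts [f] on the image of [D], which is taken as the index set; elsewhere [xget] returns
   the default [point]. *)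
pose g n : Z := xget point [set z | D z /\ f z = n].
have gf z : D z -> g (f z) = z.
  move=> Dz; have [Dg] : [set z' | D z' /\ f z' = f z] (g (f z)) by exact: (xgetI _ (x := z)).
  by move=> /finj; apply; rewrite inE.
have ainj : set_inj (f @` D) (fst \o g).
  move=> i j; rewrite !inE => -[z Dz <-] [z' Dz' <-] /=.
  by rewrite !gf// => /Dinj -> .
pose a := @Atoms R S (f @` D) (fst \o g) (snd \o g) ainj.
have aD : atoms_set a = D.
  apply/seteqP; split => [_ [_ [z Dz <-] <-]|z Dz] /=.
    by rewrite gf//; case: z Dz.
  by exists (f z); [exists z|rewrite /= gf//; case: z Dz].
pose m : {measure set (borel S) -> \bar R} :=
  dirac_sum (atom_idx a) (fun i => wt_nonneg (atom_pos a i, atom_wt a i)) (atom_pos a).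
have mE (A : set (borel S)) : m A = \esum_(z in D `&` fst @^-1` A) (wt z)%:E.
  by rewrite -aD; exact: (dirac_sum_atoms a fst wt_nonneg).
have [nu nuE] : exists nu : radon_measure S, forall A : set (borel S), measurable A -> nu A = m A.
  apply: radon_extension => K /compact_bounded_mdist[r Kr]; rewrite mE.
  apply: le_lt_trans (Dfin r); apply: esum_subset.
  by move=> z [Dz Kz]; split => //; exact: Kr.
have na : exists a, atoms_of nu a by exists a => A mA; exact: nuE.
exists (DiscreteMeasure na); rewrite -aD; apply: atoms_of_atomset => A mA; exact: nuE.
Qed.

End atoms.

(** * Positions and logarithmic weights *)

Section product_metric.
Context {R : realType} {S : rootedMetricType R}.
Local Notation Z := (S * posreal R)%type.
Implicit Types (z : Z) (r e : R).

Lemma mdist_pairE z z' : mdist z z' = Num.max (mdist z.1 z'.1) `|ln (wt z) - ln (wt z')|.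
Proof. by []. Qed.

Lemma mdist_fst z z' : mdist z.1 z'.1 <= mdist z z'.
Proof. by rewrite mdist_pairE le_max lexx. Qed.

Lemma ln_wt_point : ln (wt (point : Z)) = 0.
Proof. by rewrite /wt /= ln1. Qed.

Lemma mdist_wt z z' e : mdist z z' < e -> wt z <= expR e * wt z'.
Proof.
rewrite mdist_pairE gt_max => /andP[_]; rewrite ltr_norml => /andP[_ h].
rewrite -[wt z]lnK ?posrE ?wt_gt0// -[wt z' in leRHS]lnK ?posrE ?wt_gt0//.
by rewrite -expRD ler_expR -lerBlDr ltW.
Qed.

Lemma ball_pair_fst r z : ball (point : Z) r z -> ball (point : S) r z.1.
Proof.
move=> /ball_mdistP h; apply/ball_mdistP; apply: le_lt_trans h.
exact: (mdist_fst point z).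
Qed.

Lemma ball_pair_wt r z : ball (point : Z) r z -> expR (- r) < wt z.
Proof.
move=> /ball_mdistP; rewrite mdist_pairE gt_max ln_wt_point sub0r normrN => /andP[_].
rewrite ltr_norml => /andP[h _].
by rewrite -[wt z]lnK ?posrE ?wt_gt0// ltr_expR.
Qed.

Lemma ball_pairP r z : mdist (point : S) z.1 < r -> expR (- r) < wt z -> wt z < expR r ->
  ball (point : Z) r z.
Proof.
move=> h1 h2 h3; apply/ball_mdistP; rewrite mdist_pairE gt_max h1 /= ln_wt_point sub0r normrN.
rewrite ltr_norml; apply/andP; split.
  by rewrite -ltr_expR lnK// posrE wt_gt0.
by rewrite -ltr_expR lnK// posrE wt_gt0.
Qed.

(** The exponential is an isometry from the real line onto [posreal R], so a closed ball is the
    continuous image of a segment. *)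
Lemma boundedly_compact_posreal : boundedly_compact (posreal R : rootedMetricType R).
Proof.
move=> v r.
pose f (t : R) : posreal R := PosNum (expR_gt0 t).
pose a := ln (v : {posnum R})%:num.
have -> : [set w : posreal R | mdist v w <= r] = f @` `[a - r, a + r]%classic.
  apply/seteqP; split => [w /= vw|_ [t /= + <-]].
    exists (ln (w : {posnum R})%:num); last first.
      by apply/val_inj; rewrite /= lnK// posrE.
    have : `|a - ln (w : {posnum R})%:num| <= r := vw.
    by rewrite /= in_itv/= ler_norml => /andP[h1 h2]; apply/andP; split; lra.
  rewrite in_itv/= => /andP[h1 h2]; have -> : mdist v (f t) = `|a - ln (expR t)| by [].
  by rewrite expRK ler_norml; apply/andP; split; lra.
apply: continuous_compact; last exact: segment_compact.
apply: continuous_subspaceT => t; apply/cvg_ballP => e e0.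
apply/nbhs_ballP; exists e => //= s ts; apply/ball_mdistP.
have -> : mdist (f t) (f s) = `|ln (expR t) - ln (expR s)| by [].
by rewrite !expRK.
Qed.

Lemma boundedly_compact_pair : boundedly_compact S ->
  boundedly_compact (Z : rootedMetricType R).
Proof.
move=> bc z r.
have -> : [set y : Z | mdist z y <= r] =
    [set y : S | mdist z.1 y <= r] `*` [set w : posreal R | mdist z.2 w <= r].
  by apply/seteqP; split => y /=; rewrite mdist_pairE ge_max => /andP.
by apply: compact_setX; [exact: bc|exact: boundedly_compact_posreal].
Qed.

End product_metric.

(** * The distance between discrete measures *)

Section discrete_distance.
Context {R : realType} {S : rootedMetricType R}.
Hypothesis bc : boundedly_compact S.
Local Notation Z := (S * posreal R)%type.
Implicit Types (z : Z) (nu : discrete_measure S) (r e : R).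

Lemma discrete_locally_finite nu : locally_finite nu.
Proof. exact: radon_locally_finite. Qed.

Lemma discrete_ball_fin nu r : (nu (ball (point : S) r) < +oo)%E.
Proof.
apply: le_lt_trans (discrete_locally_finite nu r).
by apply: le_borel; [exact: borel_ball|exact: measurable_truncset|exact: sub_truncset].
Qed.

(** An atom in the ball weighs more than [expR (- r)], so it counts for at most [expR r] times its
    weight. *)
Lemma point_process_ball nu r :
  (point_process nu (ball (point : Z) r) <= (expR r)%:E * nu (ball (point : S) r))%E.
Proof.
rewrite point_processE discreteE; last exact: borel_ball.
apply: (esum_transfer (t := id)) => //.
- by move=> z; rewrite lee_fin ltW// wt_gt0.
- by move=> z [nz /ball_pair_fst].
- move=> z [nz /ball_pair_wt zr]; rewrite -EFinM lee_fin mulrC -ler_pdivrMr ?expR_gt0//.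
  by rewrite mul1r -expRN ltW.
Qed.

Lemma point_process_locally_finite nu : locally_finite (point_process nu).
Proof.
move=> r; apply: (@le_lt_trans _ _ (point_process nu (ball (point : Z) (r + 1)))).
  apply: le_borel; [exact: measurable_truncset|exact: borel_ball|].
  by apply: truncset_ball; rewrite ltrDl.
apply: le_lt_trans (point_process_ball _ _) _.
by rewrite lte_mul_pinfty// ?lee_fin ?expR_ge0// discrete_ball_fin.
Qed.

Definition discrete_close nu nu' r e :=
  vague_close nu nu' r e /\ vague_close (point_process nu) (point_process nu') r e.

Lemma vague_close_mono (X : rootedMetricType R)
    (mu la : {measure set (borel X) -> \bar R}) r r' e e' :
  0 <= e -> r' <= r -> e <= e' -> vague_close mu la r e -> vague_close mu la r' e'.
Proof.
move=> e0 rr ee h A mA Ar.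
have h1 := h A mA (subset_trans Ar (@le_ball _ _ _ _ _ rr)).
apply: le_trans h1 _; apply: leeD; last by rewrite lee_fin.
apply: lee_pmul => //; first by rewrite lee_fin addr_ge0.
  by rewrite lee_fin lerD2l.
by apply: le_borel; [exact: borel_nbh..|exact: nbhS].
Qed.

Lemma discrete_close_mono nu nu' r r' e e' : 0 <= e -> r' <= r -> e <= e' ->
  discrete_close nu nu' r e -> discrete_close nu nu' r' e'.
Proof. by move=> e0 rr ee [h1 h2]; split; [move: h1|move: h2]; exact: vague_close_mono. Qed.

Lemma discrete_distC nu nu' : discrete_dist S nu nu' = discrete_dist S nu' nu.
Proof. by rewrite /discrete_dist vague_distC (vague_distC (point_process nu)). Qed.

(** [d] depends on neither measure, so the comparison applies along a Cauchy sequence with both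
    indices moving. *)
Lemma discrete_dist_close r e : 0 < e -> exists2 d, 0 < d &
  forall nu nu', discrete_dist S nu nu' < d -> discrete_close nu nu' r e.
Proof.
move=> e0; pose e' := Num.min e 1.
have e'0 : 0 < e' <= 1 by rewrite lt_min e0 ltr01 ge_min lexx orbT.
exists (e' * expR (- (`|r| + 1))).
  by rewrite mulr_gt0 ?expR_gt0//; case/andP: e'0.
move=> nu nu'; rewrite /discrete_dist gt_max => /andP[h1 h2].
apply: (@discrete_close_mono _ _ `|r| _ e'); rewrite ?ler_norm ?ge_min ?lexx//.
  by rewrite ltW//; case/andP: e'0.
split; apply: vague_dist_close => //.
- exact: discrete_locally_finite.
- exact: discrete_locally_finite.
- exact: point_process_locally_finite.
- exact: point_process_locally_finite.
Qed.

Lemma discrete_dist_cvg nu (nu_ : nat -> discrete_measure S) :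
  (forall r e, 0 < e -> \forall n \near \oo,
    discrete_close nu (nu_ n) r e /\ discrete_close (nu_ n) nu r e) ->
  discrete_dist S nu (nu_ n) @[n --> \oo] --> 0.
Proof.
move=> h.
have h1 : vague_dist nu (nu_ n) @[n --> \oo] --> 0.
  apply: vague_dist_cvg; first exact: discrete_locally_finite.
    by move=> n; exact: discrete_locally_finite.
  by move=> r e e0; apply: filterS (h r e e0) => n [[? _] []].
have h2 : vague_dist (point_process nu) (point_process (nu_ n)) @[n --> \oo] --> 0.
  apply: vague_dist_cvg; first exact: point_process_locally_finite.
    by move=> n; exact: point_process_locally_finite.
  by move=> r e e0; apply: filterS (h r e e0) => n [[_ ?] []].
have h12 : vague_dist nu (nu_ n) +
    vague_dist (point_process nu) (point_process (nu_ n)) @[n --> \oo] --> (0 : R).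
  by rewrite -[X in _ --> X](addr0 (0 : R)); exact: cvgD.
apply: (squeeze_cvgr _ (cvg_cst 0) h12); apply: nearW => n.
by rewrite /discrete_dist le_max vague_dist_ge0 ge_max lerDl lerDr !vague_dist_ge0.
Qed.

Lemma is_metric_discrete_dist : is_metric (discrete_dist S).
Proof.
split.
- by move=> nu; rewrite /discrete_dist !vague_distxx maxxx.
- move=> nu nu' h; apply: discrete_measure_eq.
  apply: vague_dist_eq0; [exact: discrete_locally_finite..|].
  apply/eqP; rewrite eq_le vague_dist_ge0 andbT -h /discrete_dist le_max lexx//.
- exact: discrete_distC.
- move=> x y z; rewrite /discrete_dist ge_max; apply/andP; split.
    have := vague_dist_triangle (discrete_locally_finite x) (discrete_locally_finite y)
      (discrete_locally_finite z).
    by move=> /le_trans; apply; apply: lerD; rewrite le_max lexx.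
  have := vague_dist_triangle (point_process_locally_finite x)
    (point_process_locally_finite y) (point_process_locally_finite z).
  by move=> /le_trans; apply; apply: lerD; rewrite le_max lexx orbT.
Qed.

(** Mass is placed on the product space so that [A] can select atoms by weight as well as by
    position. *)
Definition atom_mass nu (A : set Z) : \bar R := \esum_(z in atomset nu `&` A) (wt z)%:E.

(** From [1 - e <= expR (- e)] one gets [expR e <= 1 / (1 - e)], which is at most [1 + 2 * e] for
    [e <= 1 / 2]. *)
Lemma expR_le1D e : 0 <= e -> e <= 1 / 2 -> expR e <= 1 + 2 * e.
Proof.
move=> e0 e1; have h := expR_ge1Dx (- e).
have h1 : 0 < 1 - e by lra.
have : expR e * (1 - e) <= 1.
  by rewrite -[leRHS](mulVf (lt0r_neq0 (expR_gt0 (- e)))) -expRN opprK ler_pM2l ?expR_gt0//.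
rewrite -ler_pdivlMr// => /le_trans; apply; rewrite ler_pdivrMr//.
have he : e * e <= e * (1 / 2) by rewrite ler_wpM2l.
lra.
Qed.

(** Moving an atom by less than [e] changes its weight by a factor at most [expR e], hence the
    [2 * e], and the unmatched atoms cost at most [e] in mass. For the point processes the unmatched
    atoms cost nothing, because they are too light to lie in the ball. *)
Lemma matching_close nu nu' (G : set Z) (t : Z -> Z) r e : 0 < e -> e <= 1 / 2 ->
  e < expR (- r) -> G `<=` atomset nu -> set_inj G t ->
  (forall z, G z -> atomset nu' (t z)) -> (forall z, G z -> mdist z (t z) < e) ->
  (atom_mass nu (fst @^-1` ball (point : S) r `\` G) <= e%:E)%E ->
  discrete_close nu nu' r (2 * e).
Proof.
move=> e0 e1 er GD tinj tD te rest.
have wt_ge0 z : (0 <= (wt z)%:E)%E by rewrite lee_fin ltW// wt_gt0.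
split.
  move=> A mA Ar; rewrite !discreteE//; last exact: borel_nbh.
  rewrite (esumID G); last by move=> z _; exact: wt_ge0.
  apply: leeD.
    apply: (@le_trans _ _ ((expR e)%:E *
        \esum_(z in atomset nu' `&` fst @^-1` (nbh A (2 * e))) (wt z)%:E)%E).
      apply: (esum_transfer (t := t)) => //.
      - by move=> x y /set_mem[_ Gx] /set_mem[_ Gy]; apply: tinj; exact/mem_set.
      - move=> z [[Dz Az] Gz]; split; first exact: tD.
        exists z.1 => //; rewrite metric_sym; apply: le_lt_trans (mdist_fst _ _) _.
        by apply: lt_le_trans (te _ Gz) _; clear -e0; lra.
      - by move=> z [[Dz Az] Gz]; rewrite -EFinM lee_fin; apply: mdist_wt; exact: te.
    rewrite lee_wpmul2r//; first exact: esum_ge0.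
    by rewrite lee_fin expR_le1D// ltW.
  apply: (@le_trans _ _ e%:E); last by rewrite lee_fin; clear -e0; lra.
  apply: le_trans rest; apply: esum_subset => z [[Dz Az] Gz].
  by split => //; split => //; exact: Ar.
move=> A mA Ar; rewrite !point_processE.
(* An atom in the ball weighs more than [expR (- r)], hence more than the whole leftover mass. *)
have DG z : atomset nu z -> A z -> G z.
  move=> Dz Az; apply: contrapT => Gz; have /ball_pair_wt := Ar z Az.
  apply/negP; rewrite -leNgt (le_trans _ (ltW er))// -lee_fin; apply: le_trans rest.
  rewrite -[leLHS](esum_set1 (a := fun z => (wt z)%:E))//; apply: esum_subset => _ ->.
  by split => //; split => //; apply: ball_pair_fst; exact: Ar.
rewrite -[leLHS]adde0; apply: leeD; last by rewrite lee_fin; clear -e0; lra.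
apply: (@le_trans _ _ (1%:E * \esum_(z in atomset nu' `&` nbh A (2 * e)) 1)%E).
  apply: (esum_transfer (t := t)) => //.
  - move=> x y /set_mem[Dx Ax] /set_mem[Dy Ay]; apply: tinj; apply/mem_set; exact: DG.
  - move=> z [Dz Az]; split; first exact/tD/DG.
    exists z => //; rewrite metric_sym; apply: lt_le_trans (te _ (DG _ Dz Az)) _.
    by clear -e0; lra.
  - by move=> z _; rewrite mul1e.
rewrite lee_wpmul2r//; first exact: esum_ge0.
by rewrite lee_fin lerDl; clear -e0; lra.
Qed.

End discrete_distance.

Lemma finite_lower_bound (R : realType) (T : choiceType) (F : set T) (g : T -> R) :
  finite_set F -> (forall x, F x -> 0 < g x) ->
  exists2 d, 0 < d & forall x, F x -> d <= g x.
Proof.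
move=> /finite_setP[n]; elim: n F => [|n IH] F.
  by rewrite II0 card_eq0 => /eqP -> _; exists 1.
move=> /eq_cardSP[x Fx FN] g0.
have [|d d0 dF] := IH _ FN; first by move=> y [/g0].
exists (Num.min d (g x)); first by rewrite lt_min d0 g0.
move=> y Fy; rewrite ge_min; have [->|/eqP yx] := eqVneq y x; first by rewrite lexx orbT.
by rewrite dF.
Qed.

Lemma finite_separation (R : realType) (X : metricType R) (F : set X) : finite_set F ->
  exists2 d : R, 0 < d & forall x y, F x -> F y -> x <> y -> d <= mdist x y.
Proof.
move=> finF; have finFF : finite_set (F `*` F) by exact: finite_setX.
(* Diagonal pairs are given the value 1 in place of their distance 0. *)
have [|d d0 h] := @finite_lower_bound R _ _
    (fun p => if p.1 == p.2 then 1 else mdist p.1 p.2 : R) finFF.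
  by move=> [x y] _ /=; case: eqVneq => // xy; rewrite mdist_gt0.
exists d => // x y Fx Fy /eqP xy; have := h (x, y) (conj Fx Fy).
by rewrite /= (negbTE xy).
Qed.

Lemma finite_upper_bound (R : realType) (T : choiceType) (F : set T) (g : T -> R) :
  finite_set F -> exists d, forall x, F x -> g x <= d.
Proof.
move=> finF; have [|d d0 h] := @finite_lower_bound R _ _ (fun x => (1 + `|g x|)^-1) finF.
  by move=> x _; rewrite invr_gt0 ltr_wpDr.
exists d^-1 => x /h; rewrite -[leLHS]invrK lef_pV2 ?posrE ?invr_gt0 ?ltr_wpDr//.
by apply: le_trans; rewrite (le_trans (ler_norm _))// lerDr.
Qed.

Lemma wt_ge0 (R : realType) (S : rootedMetricType R) (z : S * posreal R) :
  (0 <= (wt z)%:E)%E.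
Proof. by rewrite lee_fin ltW// wt_gt0. Qed.

#[local] Hint Resolve wt_ge0 : core.

(** * Matching the atoms of nearby measures *)

Section local_matching.
Context {R : realType} {S : rootedMetricType R}.
Hypothesis bc : boundedly_compact S.
Local Notation Z := (S * posreal R)%type.
Implicit Types (z : Z) (nu : discrete_measure S) (r e : R).

Lemma atom_mass_ge0 nu A : (0 <= atom_mass nu A)%E.
Proof. by rewrite /atom_mass esum_ge0. Qed.

Lemma atom_massS nu A B : A `<=` B -> (atom_mass nu A <= atom_mass nu B)%E.
Proof. by move=> AB; apply: esum_subset; exact: setIS. Qed.

Lemma atom_mass_ge nu z (A : set Z) : atomset nu z -> A z -> ((wt z)%:E <= atom_mass nu A)%E.
Proof.
move=> Dz Az; rewrite -[leLHS](esum_set1 (a := fun z => (wt z)%:E))//.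
by apply: esum_subset => _ ->.
Qed.

Lemma atom_mass_ball nu r : (atom_mass nu (fst @^-1` ball (point : S) r) < +oo)%E.
Proof.
rewrite /atom_mass -discreteE; last exact: borel_ball.
exact: discrete_ball_fin.
Qed.

Lemma atom_mass_core nu r e : 0 < e -> exists F : set Z,
  [/\ finite_set F, F `<=` atomset nu `&` fst @^-1` ball (point : S) r &
      (atom_mass nu (fst @^-1` ball (point : S) r `\` F) <= e%:E)%E].
Proof.
move=> e0; set A := atomset nu `&` fst @^-1` ball (point : S) r.
have fA : \esum_(z in A) (wt z)%:E \is a fin_num.
  by rewrite ge0_fin_numE ?atom_mass_ball// esum_ge0.
have [_ [F [finF FA] <-] hF] := ub_ereal_sup_adherent e0 fA.
exists F; split => //.
have sF : \esum_(z in A `&` F) (wt z)%:E = \sum_(z \in F) (wt z)%:E.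
  by rewrite (setIidr FA) esum_fset.
have -> : atom_mass nu (fst @^-1` ball (point : S) r `\` F) = \esum_(z in A `&` ~` F) (wt z)%:E.
  by rewrite /atom_mass setDE setIA.
move: hF fA; rewrite -[ereal_sup _]/(\esum_(z in A) (wt z)%:E) (esumID F); last first.
  by move=> z _; exact: wt_ge0.
rewrite sF fin_numD => + /andP[].
case: (\sum_(z \in F) _) => [x| |]//=; case: (\esum_(z in _) _) => [y| |]//= hF _ _.
have : ((x + y - e)%:E < x%:E)%E by exact: hF.
by rewrite lte_fin lee_fin; lra.
Qed.

(** Test the comparison on the singleton of [z], which counts 1: with no atom of [nu'] nearby it
    would read [1 <= e]. *)
Lemma point_process_close_atom nu nu' r e z :
  vague_close (point_process nu) (point_process nu') r e -> e < 1 ->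
  atomset nu z -> ball (point : Z) r z ->
  exists2 z', atomset nu' z' & mdist z z' < e.
Proof.
move=> pc e1 nz zr; apply: contrapT => /forall2NP nex.
have := pc [set z] (@borel_set1 _ (Z : rootedMetricType R) z).
move=> /(_ _)/wrap[]; first by move=> _ ->.
rewrite !point_processE (_ : _ `&` [set z] = [set z]); last first.
  by apply/seteqP; split => [y []|_ ->].
rewrite (_ : _ `&` nbh _ _ = set0); last first.
  rewrite -subset0 => z' [Dz' [_ -> z'z]]; case: (nex z') => //; apply.
  by rewrite metric_sym.
by rewrite esum_set1// esum_set0 mule0 add0e lee_fin leNgt e1.
Qed.

(** The finite set [F] depends on [r] and [eta] but not on [e], so the precision [e] may be chosen
    after the weights and mutual distances in [F] are known. Closeness of the point processes
    provides the partners of [F]; closeness of the measures bounds what is left of [nu']. *)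
Lemma local_matching nu r eta : 0 < eta -> exists F : set Z,
  [/\ finite_set F, F `<=` atomset nu,
    (atom_mass nu (fst @^-1` ball (point : S) r `\` F) <= eta%:E)%E &
    forall e, 0 < e -> exists2 d, 0 < d & forall nu', discrete_dist S nu nu' < d ->
      exists t : Z -> Z,
        [/\ set_inj F t, forall z, F z -> atomset nu' (t z),
            forall z, F z -> mdist z (t z) < e &
            (atom_mass nu' (fst @^-1` ball (point : S) r `\` t @` F) <= eta%:E)%E]].
Proof.
move=> eta0; have eta4 : 0 < eta / 4 by rewrite divr_gt0.
have [F [finF FA Frest]] := atom_mass_core nu (r + 1) eta4.
have FD : F `<=` atomset nu by move=> z /FA[].
exists F; split => //.
  apply: (@le_trans _ _ (eta / 4)%:E); last by rewrite lee_fin; clear -bc eta0; lra.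
  apply: le_trans Frest; apply: atom_massS => z [/ball_mdistP zr Fz]; split => //.
  by apply/ball_mdistP; rewrite (lt_le_trans zr)// lerDl.
move=> e e0.
have [s s0 hs] := finite_separation finF.
have [m m0 hm] : exists2 m, 0 < m & forall z, F z -> m <= r + 1 - mdist (point : S) z.1.
  by apply: finite_lower_bound => // z /FA[_ /ball_mdistP zr]; rewrite subr_gt0.
have [rho hrho] := finite_upper_bound (fun z : Z => mdist (point : Z) z) finF.
set W := \esum_(z in F) (wt z)%:E.
have fW : W \is a fin_num.
  rewrite ge0_fin_numE ?esum_ge0//; apply: le_lt_trans (atom_mass_ball nu (r + 1)).
  exact: esum_subset.
set w := fine W; have w0 : 0 <= w by rewrite fine_ge0// esum_ge0.
have WE : W = w%:E by rewrite fineK.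
have c0 : 0 < eta / 2 / (2 * w + 1) by rewrite !divr_gt0// ltr_wpDl// mulr_ge0.
(* This number is called [a] below. The bound [s / 2] makes the matching injective, and [m / 2]
   keeps the [a]-neighbourhood of the moved atoms within radius [r + 1]. The leftover mass will be
   at most [a * (2 * w + 1) + (1 + a) * (eta / 4)]: the last bound makes the first term at most
   [eta / 2], and [a <= 1 / 2] keeps the second below [eta / 2]. *)
pose e' := Num.min (Num.min e (1 / 2)) (Num.min (Num.min (s / 2) (m / 2)) (eta / 2 / (2 * w + 1))).
have e'0 : 0 < e' by rewrite !lt_min e0 c0 !divr_gt0.
have : e' <= e' by [].
rewrite {2}/e' !le_min => /andP[/andP[e'e e'1] /andP[/andP[e's e'm] e'c]].
have {}e'c : e' * (2 * w + 1) <= eta / 2.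
  by rewrite -ler_pdivlMr// ltr_wpDl// mulr_ge0.
move: e' e'0 e'e e'1 e's e'm e'c {c0} => a a0 ae a1 as2 am ac.
have [d d0 hd] := discrete_dist_close bc (Num.max (rho + 1) (r + 1)) a0.
exists d => // nu' nud.
have [_ pc] := hd nu nu' nud.
have nud' : discrete_dist S nu' nu < d by rewrite discrete_distC.
have [nc _] := hd nu' nu nud'.
have near_atom z : F z -> exists2 z', atomset nu' z' & mdist z z' < a.
  move=> Fz; apply: point_process_close_atom pc _ (FD _ Fz) _; first by move: a1; clear -bc; lra.
  by apply/ball_mdistP; rewrite (le_lt_trans (hrho _ Fz))// lt_max ltrDl ltr01.
have [t ht] : {t : Z -> Z & forall z, F z -> atomset nu' (t z) /\ mdist z (t z) < a}.
  apply: (@choice _ _ (fun z z' => F z -> atomset nu' z' /\ mdist z z' < a)) => z.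
  have [Fz|nFz] := pselect (F z); last by exists z.
  by have [z' ? ?] := near_atom z Fz; exists z'.
have tinj : set_inj F t.
  move=> x y /set_mem Fx /set_mem Fy txy; apply: contrapT => xy.
  have := hs _ _ Fx Fy xy; apply/negP; rewrite -ltNge.
  apply: le_lt_trans (metric_triangle x (t x) y) _.
  have [_ h1] := ht _ Fx; have [_ h2] := ht _ Fy.
  by rewrite {2}txy (metric_sym (t y)); move: h1 h2 as2; clear -bc; lra.
exists t; split => //; [by move=> z /ht[]|by move=> z /ht[_ /lt_le_trans]; exact|].
(* Moved atoms may lie outside the ball of radius [r]; their positions are adjoined so that all
   their weights can be subtracted from the mass of [B]. *)
set B := ball (point : S) r `|` fst @` (t @` F).
have mB : measurable (B : set (borel S)).
  apply: measurableU; first exact: borel_ball.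
  have finB : finite_set (fst @` (t @` F)) by do 2 apply: finite_image.
  rewrite (_ : fst @` (t @` F) = \bigcup_(x in fst @` (t @` F)) [set x]); last first.
    by apply/seteqP; split => [x ?|x [y ? ->]]//; exists x.
  by apply: fin_bigcup_measurable => // x _; exact: borel_set1.
have margin x : B x -> mdist (point : S) x <= r + 1 - a.
  move=> [/ball_mdistP h|[_ [z Fz <-] <-]].
    by move: h a1; clear -bc; lra.
  have [_ h2] := ht _ Fz; have h3 := hm _ Fz.
  have h4 := le_lt_trans (mdist_fst z (t z)) h2.
  apply: le_trans (metric_triangle point z.1 (t z).1) _.
  by move: h4 h3 am; clear -bc; lra.
have Br : B `<=` ball (point : S) (r + 1).
  by move=> x /margin h; apply/ball_mdistP; move: h a0; clear -bc; lra.
have nBr : nbh B a `<=` ball (point : S) (r + 1).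
  move=> x [y /margin h xy]; apply/ball_mdistP.
  apply: le_lt_trans (metric_triangle point y x) _; rewrite (metric_sym y).
  by move: h xy; clear -bc; lra.
(* [nu' B] is at most about the mass [w] of [F], and the moved atoms [t @` F]
   already account for that much. *)
have h1 : (nu' B <= ((1 + a) * (w + eta / 4) + a)%:E)%E.
  have := nc B mB; move=> /(_ _)/wrap[].
    by move=> x /Br/ball_mdistP h; apply/ball_mdistP/(lt_le_trans h); rewrite le_max lexx orbT.
  move=> /le_trans; apply.
  rewrite [leRHS](_ : _ = (1 + a)%:E * (w + eta / 4)%:E + a%:E)%E//; apply: leeD => //.
  apply: lee_wpmul2l; first by rewrite lee_fin addr_ge0// ltW.
  apply: (@le_trans _ _ (nu (ball (point : S) (r + 1)))).
    by apply: le_borel; [exact: borel_nbh|exact: borel_ball|].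
  rewrite discreteE; last exact: borel_ball.
  rewrite (esumID F); last by move=> z _; exact: wt_ge0.
  rewrite (setIidr FA) -/W WE EFinD leeD2l//.
  by rewrite -setIA -setDE.
set W' := \esum_(z in t @` F) (wt z)%:E.
set rest := atom_mass _ _.
have h2 : (rest + W' <= nu' B)%E.
  rewrite discreteE// addeC (esumID (t @` F)); last by move=> z _; exact: wt_ge0.
  apply: leeD; apply: esum_subset.
    move=> _ [z Fz <-]; split; last by exists z.
    split; first exact: (ht _ Fz).1.
    by apply: or_intror; exists (t z) => //; exists z.
  by move=> z [Dz [zr nz]]; exact: (conj (conj Dz (or_introl zr)) nz).
have h3 : (W <= (expR a)%:E * W')%E.
  apply: (esum_transfer (t := t)) => //.
  by move=> z /ht[_ h]; rewrite -EFinM lee_fin; exact: mdist_wt.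
have rest0 : (0 <= rest)%E by exact: atom_mass_ge0.
have W'0 : (0 <= W')%E by rewrite /W' esum_ge0.
have fin2 : (rest + W' < +oo)%E by apply: (le_lt_trans h2); apply: (le_lt_trans h1); rewrite ltry.
have fr : rest \is a fin_num.
  by rewrite ge0_fin_numE//; apply: le_lt_trans fin2; rewrite leeDl.
have fW' : W' \is a fin_num.
  by rewrite ge0_fin_numE//; apply: le_lt_trans fin2; rewrite leeDr.
have := le_trans h2 h1; move: h3; rewrite WE -(fineK fr) -(fineK fW') -EFinM -EFinD !lee_fin.
move: (fine rest) (fine W') => x y wy xy.
have y1 : (1 - a) * w <= y.
  have : expR (- a) * w <= y.
    by rewrite expRN -ler_pdivlMl ?invr_gt0 ?expR_gt0// invrK.
  by apply: le_trans; rewrite ler_wpM2r// expR_ge1Dx.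
have ae4 : a * (eta / 4) <= 1 / 2 * (eta / 4) by rewrite ler_wpM2r// ltW.
move: xy y1 ae4 ac a0 eta0; clear -bc; lra.
Qed.

End local_matching.

Lemma finite_eventually (T : choiceType) (F : set T) (P : nat -> T -> Prop) :
  finite_set F ->
  (forall x, F x -> exists N, forall n, (N <= n)%N -> P n x) ->
  exists N, forall n, (N <= n)%N -> forall x, F x -> P n x.
Proof.
move=> /finite_setP[n]; elim: n F => [|n IH] F.
  by rewrite II0 card_eq0 => /eqP -> _; exists 0%N.
move=> /eq_cardSP[x Fx FN] h.
have [|N hN] := IH _ FN; first by move=> y [/h].
have [M hM] := h x Fx; exists (maxn N M) => m; rewrite geq_max => /andP[Nm Mm] y Fy.
by have [->|/eqP yx] := eqVneq y x; [exact: hM|exact: hN].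
Qed.

(** * Limits of controlled Cauchy sequences *)

Section limit.
Context {R : realType} {S : rootedMetricType R}.
Hypothesis bc : boundedly_compact S.
Local Notation Z := (S * posreal R)%type.
Implicit Types (z : Z) (r e : R).

Variable u : nat -> discrete_measure S.
Hypothesis u_close : forall r e, 0 < e ->
  exists N, forall m n, (N <= m)%N -> (N <= n)%N -> discrete_close (u m) (u n) r e.
Hypothesis u_small : forall r e, 0 < e -> exists2 d, 0 < d &
  exists N, forall n, (N <= n)%N ->
    (atom_mass (u n) (fst @^-1` ball (point : S) r `&` [set z | (wt z < d)%R]) <= e%:E)%E.
Hypothesis u_sep : forall r, exists2 d, 0 < d & exists N, forall n, (N <= n)%N ->
  forall z z', atomset (u n) z -> atomset (u n) z' ->
    ball (point : Z) r z -> ball (point : Z) r z' -> z <> z' -> d <= mdist z.1 z'.1.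

(** The Kuratowski lower limit of the sets [atomset (u n)], for which no sequence of atoms has to be
    chosen. *)
Definition limit_atoms : set Z := [set z | forall e, 0 < e ->
  exists N, forall n, (N <= n)%N -> exists2 z', atomset (u n) z' & mdist z z' < e].

Let u_atom r e : 0 < e -> exists N, forall m n, (N <= m)%N -> (N <= n)%N ->
  forall z, atomset (u m) z -> ball (point : Z) r z ->
    exists2 z', atomset (u n) z' & mdist z z' < e.
Proof.
move=> e0; pose e' := Num.min e (1 / 2).
have e'0 : 0 < e' by rewrite lt_min e0 divr_gt0.
have e'1 : e' < 1 by rewrite gt_min; apply/orP; right; lra.
have [N hN] := u_close r e'0; exists N => m n Nm Nn z uz zr.
have [_ pc] := hN m n Nm Nn.
have [z' uz' zz'] := point_process_close_atom pc e'1 uz zr.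
by exists z' => //; apply: lt_le_trans zz' _; rewrite ge_min lexx.
Qed.

Lemma to_limit_atoms r e : 0 < e -> exists N, forall n, (N <= n)%N ->
  forall z, atomset (u n) z -> ball (point : Z) r z ->
    exists2 z', limit_atoms z' & mdist z z' < e.
Proof.
move=> e0; have e20 : 0 < e / 2 by rewrite divr_gt0.
have [N hN] := u_atom r e20.
exists N => n Nn z uz zr.
have [w hw] : {w : nat -> Z & forall m, (N <= m)%N -> atomset (u m) (w m) /\ mdist z (w m) < e / 2}.
  apply: (@choice _ _ (fun m w => (N <= m)%N -> atomset (u m) w /\ mdist z w < e / 2)) => m.
  have [Nm|/negP Nm] := boolP (N <= m)%N; last by exists z.
  by have [w ? ?] := hN n m Nn Nm z uz zr; exists w.
(* A cluster point of atoms [w m] of [u m] close to [z] is a limit atom, as atoms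
   of [u m] and [u k] follow each other for large [m] and [k]. *)
have cZ : compact [set y : Z | mdist z y <= e / 2] := @boundedly_compact_pair R S bc z (e / 2).
have [|p [/= zp clp]] := cZ (w @ \oo) _.
  by exists N => // m /= Nm; apply/ltW; case: (hw m Nm).
exists p; last by apply: le_lt_trans zp _; rewrite gtr_pMr// invf_lt1// ltr1n.
move=> d d0; have d20 : 0 < d / 2 by rewrite divr_gt0.
have [M hM] := u_atom (r + e / 2) d20; exists M => k Mk.
have [q [[/= m /andP[Nm Mm] <-] /ball_mdistP pm]] :
    [set w m | m in [set m | (N <= m)%N && (M <= m)%N]] `&` ball p (d / 2) !=set0.
  apply: clp; last exact: nbhsx_ballx.
  exists (maxn N M) => // m /=; rewrite geq_max => h; by exists m.
have [um zm] := hw m Nm.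
have [||z' uz' mz'] := hM m k Mm Mk (w m) => //.
  move: zr => /ball_mdistP zr; apply/ball_mdistP.
  by apply: le_lt_trans (metric_triangle _ z _) _; exact: ltrD.
exists z' => //; apply: le_lt_trans (metric_triangle _ (w m) _) _.
by rewrite [ltRHS]splitr; exact: ltrD.
Qed.

Lemma from_limit_atoms (F : set Z) e : finite_set F -> F `<=` limit_atoms -> 0 < e ->
  exists N, forall n, (N <= n)%N -> exists t : Z -> Z,
    [/\ set_inj F t, forall z, F z -> atomset (u n) (t z) &
        forall z, F z -> mdist z (t z) < e].
Proof.
move=> finF FL e0.
have [s s0 hs] := finite_separation finF.
pose d := Num.min e (s / 2); have d0 : 0 < d by rewrite lt_min e0 divr_gt0.
have [N hN] := @finite_eventually _ F
  (fun n z => exists2 z', atomset (u n) z' & mdist z z' < d) finF (fun z Fz => FL z Fz d d0).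
exists N => n Nn.
have [t ht] : {t : Z -> Z & forall z, F z -> atomset (u n) (t z) /\ mdist z (t z) < d}.
  apply: (@choice _ _ (fun z w => F z -> atomset (u n) w /\ mdist z w < d)) => z.
  have [Fz|Fz] := pselect (F z); last by exists z.
  by have [w ? ?] := hN n Nn z Fz; exists w.
exists t; split; [|by move=> z /ht[]|].
  move=> x y /set_mem Fx /set_mem Fy txy; apply: contrapT => xy.
  have := hs _ _ Fx Fy xy; apply/negP; rewrite -ltNge.
  apply: le_lt_trans (metric_triangle x (t x) y) _.
  have [_ h1] := ht _ Fx; have [_ h2] := ht _ Fy.
  rewrite {2}txy (metric_sym (t y)) [ltRHS]splitr; apply: ltrD.
    by apply: lt_le_trans h1 _; rewrite ge_min lexx orbT.
  by apply: lt_le_trans h2 _; rewrite ge_min lexx orbT.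
by move=> z /ht[_ h]; apply: lt_le_trans h _; rewrite ge_min lexx.
Qed.

Section transported_mass.
Context {X : rootedMetricType R}.
Variables (f : Z -> X) (g : Z -> R).
Hypothesis f_lip : forall z z', mdist (f z) (f z') <= mdist z z'.
Hypothesis g_ge0 : forall z, 0 <= g z.
Hypothesis g_lip : forall z z' e, mdist z z' < e -> 0 < e -> g z <= expR e * g z'.

(** With [fst] and [wt] this is the discrete measure, with [id] and the constant 1 its point
    process; both halves of the distance are treated at once. *)
Let mass (D : set Z) (B : set X) : \bar R := \esum_(z in D `&` f @^-1` B) (g z)%:E.

Lemma limit_mass_le (A : set X) (F : set Z) e : finite_set F ->
  F `<=` limit_atoms `&` f @^-1` A -> 0 < e ->
  exists N, forall n, (N <= n)%N ->
    (\sum_(z \in F) (g z)%:E <= (expR e)%:E * mass (atomset (u n)) (nbh A e))%E.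
Proof.
move=> finF FL e0.
have [|N hN] := @from_limit_atoms F e finF _ e0; first by move=> z /FL[].
exists N => n /hN[t [tinj tD te]]; rewrite -esum_fset; [|exact: finF|].
  apply: (esum_transfer (t := t)) => //.
  - move=> z Fz; split; first exact: tD.
    exists (f z); first by case: (FL _ Fz).
    by rewrite metric_sym (le_lt_trans (f_lip _ _))// te.
  - by move=> z Fz; rewrite -EFinM lee_fin; apply: g_lip => //; exact: te.
by move=> z _; rewrite lee_fin.
Qed.

(** Finitely many limit atoms are first matched into [u m], where [m] depends on them and on the
    test set; then [u m] is compared with [u n] by the Cauchy property, whose threshold depends only
    on [r] and [e]. This makes the result uniform in [A]. The constant 4 comes from
    [(1 + 2 * e) * (1 + e) <= 1 + 4 * e] for [e <= 1 / 2]. *)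
Lemma limit_vague_close (mu : {measure set (borel X) -> \bar R})
    (nu_ : nat -> {measure set (borel X) -> \bar R}) :
  (forall A : set (borel X), measurable A -> mu A = mass limit_atoms A) ->
  (forall n (A : set (borel X)), measurable A -> nu_ n A = mass (atomset (u n)) A) ->
  (forall r e, 0 < e -> exists N, forall m n, (N <= m)%N -> (N <= n)%N ->
     vague_close (nu_ m) (nu_ n) r e) ->
  forall r e, 0 < e -> e <= 1 / 2 ->
    exists N, forall n, (N <= n)%N -> vague_close mu (nu_ n) r (4 * e).
Proof.
move=> muE nuE cau r e e0 e1.
have [N hN] := cau (r + e) e e0; exists N => n Nn A mA Ar.
rewrite muE//; apply: ge_ereal_sup => _ [F [finF FA] <-].
have [M hM] := limit_mass_le finF FA e0.
pose m := maxn N M; have Nm : (N <= m)%N by exact: leq_maxl.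
apply: le_trans (hM m (leq_maxr _ _)) _.
have mN (B : set X) d : measurable (nbh B d : set (borel X)) by exact: borel_nbh.
rewrite -nuE//.
have := hN m n Nm Nn (nbh A e) (mN _ _); move=> /(_ _)/wrap[].
  by apply: subset_trans (@nbh_ball _ _ _ _ _); exact: nbhS.
have : (nu_ n (nbh (nbh A e) e) <= nu_ n (nbh A (4 * e)))%E.
  apply: le_borel => //; apply: subset_trans (@nbh_nbh _ _ _ _ _) _; apply: nbhS => //.
  by lra.
set y := nu_ n (nbh (nbh A e) e); set x := nu_ n (nbh A (4 * e)) => yx wy.
have x0 : (0 <= x)%E by rewrite /x.
have cE : expR e <= 1 + 2 * e by rewrite expR_le1D// ltW.
apply: (@le_trans _ _ ((1 + 2 * e)%:E * ((1 + e)%:E * x + e%:E))%E).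
  apply: lee_pmul => //; rewrite ?lee_fin ?expR_ge0//.
  apply: le_trans wy _; rewrite leeD2r//; apply: lee_wpmul2l => //.
  by rewrite lee_fin addr_ge0// ltW.
have e2 : 0 <= 1 + 2 * e by rewrite addr_ge0// mulr_ge0// ltW.
have e3 : 0 <= 1 + e by rewrite addr_ge0// ltW.
rewrite ge0_muleDr; [|by rewrite mule_ge0// lee_fin|by rewrite lee_fin ltW].
have ee : e * e <= e * (1 / 2) by rewrite ler_wpM2l// ltW.
rewrite muleA -!EFinM; apply: leeD; last by rewrite lee_fin; move: ee e0; lra.
by apply: lee_wpmul2r => //; rewrite lee_fin; move: ee e0; lra.
Qed.

End transported_mass.

(** Two limit atoms at one position with different weights would be approached by distinct atoms of
    [u n] whose positions come arbitrarily close, against [u_sep]. *)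
Lemma limit_atoms_inj z z' : limit_atoms z -> limit_atoms z' -> z.1 = z'.1 -> z = z'.
Proof.
move=> Lz Lz' zz; apply: contrapT => /eqP zz'.
have dz : 0 < mdist z z' by rewrite mdist_gt0.
pose r := Num.max (mdist (point : Z) z) (mdist (point : Z) z') + 1.
have [s s0 [N hN]] := u_sep r.
pose e := Num.min (Num.min (s / 2) (mdist z z' / 2)) 1.
have e0 : 0 < e by rewrite !lt_min !divr_gt0//= ltr01.
have := lexx e; rewrite {2}/e !le_min => /andP[/andP[es ez] e1].
have [M1 h1] := Lz e e0; have [M2 h2] := Lz' e e0.
pose n := maxn N (maxn M1 M2).
have [a ua za] := h1 n (leq_trans (leq_maxl M1 M2) (leq_maxr _ _)).
have [b ub zb] := h2 n (leq_trans (leq_maxr M1 M2) (leq_maxr _ _)).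
have inr y c : mdist y c < e -> mdist (point : Z) y <= r - 1 -> ball (point : Z) r c.
  move=> yc yr; apply/ball_mdistP; apply: le_lt_trans (metric_triangle _ y _) _.
  by rewrite -(subrK 1 r); apply: ler_ltD => //; exact: lt_le_trans e1.
have ar : ball (point : Z) r a by apply: inr za _; rewrite /r addrK le_max lexx.
have br : ball (point : Z) r b by apply: inr zb _; rewrite /r addrK le_max lexx orbT.
have [ab|ab] := pselect (a = b).
  have := metric_triangle z a z'; rewrite {2}ab (metric_sym b z').
  apply/negP; rewrite -ltNge [ltRHS]splitr; apply: ltrD; exact: lt_le_trans ez.
have := hN n (leq_maxl _ _) a b ua ub ar br ab; apply/negP; rewrite -ltNge.
apply: le_lt_trans (metric_triangle _ z.1 _) _; rewrite metric_sym [X in _ + mdist X _]zz.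
rewrite [ltRHS]splitr; apply: ltrD.
  by apply: le_lt_trans (mdist_fst _ _) _; exact: lt_le_trans es.
by apply: le_lt_trans (mdist_fst _ _) _; exact: lt_le_trans es.
Qed.

(** All late terms are compared, at precision 1, with one fixed term of finite mass. *)
Lemma u_ball_bounded r : exists C : R, exists N, forall n, (N <= n)%N ->
  (atom_mass (u n) (fst @^-1` ball (point : S) r) <= C%:E)%E.
Proof.
have [N hN] := u_close r ltr01.
exists (fine ((1 + 1)%:E * u N (ball (point : S) (r + 1)) + 1%:E)%E).
exists N => n Nn; rewrite fineK; last first.
  rewrite ge0_fin_numE; last by rewrite adde_ge0// mule_ge0.
  by rewrite lte_add_pinfty ?ltry// lte_mul_pinfty// ?lee_fin//; exact: discrete_ball_fin.
rewrite /atom_mass -discreteE; last exact: borel_ball.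
have [h _] := hN n N Nn (leqnn N).
apply: le_trans (h _ _ _) _ => //; first exact: borel_ball.
rewrite leeD2r// lee_wpmul2l// ?lee_fin//.
by apply: le_borel; [exact: borel_nbh|exact: borel_ball|exact: nbh_ball].
Qed.

Lemma limit_atoms_mass r :
  (\esum_(z in limit_atoms `&` fst @^-1` ball (point : S) r) (wt z)%:E < +oo)%E.
Proof.
have [C [N hN]] := u_ball_bounded (r + 1).
apply: (@le_lt_trans _ _ ((expR 1)%:E * C%:E)%E); last by rewrite -EFinM ltry.
apply: ge_ereal_sup => _ [F [finF FA] <-].
have [M hM] := @limit_mass_le S fst wt mdist_fst (fun z => ltW (wt_gt0 z))
  (fun z z' e h _ => mdist_wt h) _ F 1 finF FA ltr01.
apply: le_trans (hM (maxn N M) (leq_maxr _ _)) _.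
rewrite lee_wpmul2l ?lee_fin ?expR_ge0//; apply: le_trans (hN (maxn N M) (leq_maxl _ _)).
by apply: esum_subset => z [uz zr]; split => //; exact: nbh_ball zr.
Qed.

Lemma countable_limit_atoms : countable limit_atoms.
Proof.
have -> : limit_atoms = \bigcup_n (limit_atoms `&` fst @^-1` ball (point : S) n%:R `&`
    [set z | (n.+1%:R^-1 < wt z)%R]).
  apply/seteqP; split => [z Lz|z [n _ [[]]]//].
  pose a := Num.truncn (mdist (point : S) z.1); pose b := Num.truncn (wt z)^-1.
  exists (maxn a b).+1 => //; split; first split => //.
    apply/ball_mdistP/(lt_le_trans (truncnS_gt _)).
    by rewrite ler_nat ltnS leq_maxl.
  rewrite /= invf_plt ?posrE ?wt_gt0//; apply: (lt_le_trans (truncnS_gt _)).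
  by rewrite ler_nat (leq_trans _ (leqnSn _))// ltnS leq_maxr.
apply: bigcup_countable => // n _; apply: finite_set_countable; apply: contrapT => inf.
set A := (X in finite_set X) in inf.
have [C hC] : exists C : R, forall F, finite_set F -> F `<=` A ->
    (\sum_(z \in F) (wt z)%:E <= C%:E)%E.
  exists (fine (\esum_(z in limit_atoms `&` fst @^-1` ball (point : S) n%:R) (wt z)%:E)).
  move=> F finF FA; rewrite fineK; last first.
    by rewrite ge0_fin_numE ?esum_ge0//; exact: limit_atoms_mass.
  apply: ereal_sup_ubound; exists F => //; split => //.
  by move=> z /FA[].
(* More than [C * n.+1%:R] atoms, each heavier than [1 / n.+1], would together weigh more than
   [C]. *)
have [F FA cF] := infinite_set_fset (Num.truncn (C * n.+1%:R)).+1 inf.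
have := hC _ (finite_fset F) FA; apply/negP; rewrite -ltNge.
apply: (@lt_le_trans _ _ (\sum_(z \in [set` F]) (n.+1%:R^-1)%:E)%E); last first.
  by apply: lee_fsum => // z /FA[_ /= /ltW]; rewrite lee_fin.
rewrite fsbig_finite//= set_fsetK sumEFin lte_fin big_const_seq count_predT iter_addr_0.
rewrite -[X in _ < X]mulr_natr ltr_pdivlMl// mulrC (lt_le_trans (truncnS_gt _))// ler_nat//.
Qed.

Lemma limit_close_from nu : atomset nu = limit_atoms -> forall r e, 0 < e ->
  exists N, forall n, (N <= n)%N -> discrete_close nu (u n) r e.
Proof.
move=> nuE r e e0; pose a := Num.min (e / 4) (1 / 2).
have a0 : 0 < a by rewrite lt_min !divr_gt0.
have a1 : a <= 1 / 2 by rewrite ge_min lexx orbT.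
have ae : 4 * a <= e by rewrite mulrC -ler_pdivlMr// ge_min lexx.
have [N hN] : exists N, forall n, (N <= n)%N -> vague_close nu (u n) r (4 * a).
  apply: (limit_vague_close (f := fst) (g := @wt R S)) => //.
  - exact: mdist_fst.
  - by move=> z; exact/ltW/wt_gt0.
  - by move=> z z' d /mdist_wt.
  - by move=> A mA; rewrite discreteE// nuE.
  - by move=> n A mA; rewrite discreteE.
  - move=> r' e' /(u_close r')[N hN]; exists N => m n Nm Nn.
    by have [] := hN m n Nm Nn.
have [M hM] : exists N, forall n, (N <= n)%N ->
    vague_close (point_process nu) (point_process (u n)) r (4 * a).
  apply: (limit_vague_close (f := id) (g := fun=> 1)) => //.
  - by move=> z z' d _ d0; rewrite mulr1 -expR0 ler_expR ltW.
  - by move=> A mA; rewrite point_processE nuE.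
  - by move=> n A mA; rewrite point_processE.
  - move=> r' e' /(u_close r')[N' hN']; exists N' => m n Nm Nn.
    by have [] := hN' m n Nm Nn.
exists (maxn N M) => n; rewrite geq_max => /andP[Nn Mn].
have a4 : 0 <= 4 * a by rewrite mulr_ge0// ltW.
by split; apply: (vague_close_mono a4 (lexx r) ae); [exact: hN|exact: hM].
Qed.

(** Apply [matching_close] to the atoms of [u n] of weight at least [d]. Each has a limit atom
    nearby, [u_sep] makes the matching injective, and [u_small] bounds the mass of the lighter
    atoms. *)
Lemma limit_close_to nu : atomset nu = limit_atoms -> forall r e, 0 < e ->
  exists N, forall n, (N <= n)%N -> discrete_close (u n) nu r e.
Proof.
move=> nuE r e e0; pose a := Num.min (Num.min (e / 2) (1 / 2)) (expR (- r) / 2).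
have a0 : 0 < a by rewrite !lt_min !divr_gt0//= expR_gt0.
have := lexx a; rewrite {2}/a !le_min => /andP[/andP[ae a1] ar].
have {}ar : a < expR (- r).
  by rewrite (le_lt_trans ar)// gtr_pMr ?expR_gt0// invf_lt1// ltr1n.
have {}ae : 2 * a <= e by rewrite mulrC -ler_pdivlMr.
have [d d0 [N1 h1]] := u_small r a0.
have [C [N2 h2]] := u_ball_bounded r.
(* Large enough for the product ball to contain [G]: [1 - ln d] takes care of the weights near [d],
   and [C] of the heavy ones, since no atom outweighs the mass of the ball and
   [C < 1 + rho <= expR rho]. *)
pose rho := Num.max r (Num.max (1 - ln d) C).
have [s s0 [N3 h3]] := u_sep rho.
pose b := Num.min a (s / 2); have b0 : 0 < b by rewrite lt_min a0 divr_gt0.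
have [N4 h4] := to_limit_atoms rho b0.
exists (maxn (maxn N1 N2) (maxn N3 N4)) => n.
rewrite !geq_max => /andP[/andP[n1 n2] /andP[n3 n4]].
pose G := atomset (u n) `&` (fst @^-1` ball (point : S) r) `&` [set z | d <= wt z].
have Grho z : G z -> ball (point : Z) rho z.
  move=> [[Dz zr] /= dz]; apply: ball_pairP.
  - by move: zr => /ball_mdistP zr; rewrite (lt_le_trans zr)// le_max lexx.
  - rewrite (lt_le_trans _ dz)// -[ltRHS]lnK ?posrE// ltr_expR ltrNl.
    rewrite (@lt_le_trans _ _ (1 - ln d))//; first by rewrite ltrDr.
    by rewrite !le_max lexx orbT.
  - apply: (@le_lt_trans _ _ C).
      by rewrite -lee_fin; apply: le_trans (h2 n n2); exact: atom_mass_ge.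
    apply: lt_le_trans (expR_ge1Dx _); rewrite addrC ltr_pwDr// !le_max lexx !orbT//.
have [t ht] : {t : Z -> Z & forall z, G z -> limit_atoms (t z) /\ mdist z (t z) < b}.
  apply: (@choice _ _ (fun z w => G z -> limit_atoms w /\ mdist z w < b)) => z.
  have [Gz|Gz] := pselect (G z); last by exists z.
  have [w ? ?] := h4 n n4 z Gz.1.1 (Grho z Gz); by exists w.
apply: (discrete_close_mono _ (lexx r) ae); first by rewrite mulr_ge0// ltW.
apply: (@matching_close _ _ _ _ G t) => //.
- by move=> z [[]].
- move=> x y /set_mem Gx /set_mem Gy txy; apply: contrapT => xy.
  have := h3 n n3 _ _ Gx.1.1 Gy.1.1 (Grho _ Gx) (Grho _ Gy) xy; apply/negP; rewrite -ltNge.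
  have [_ hx] := ht _ Gx; have [_ hy] := ht _ Gy.
  apply: le_lt_trans (mdist_fst x y) _.
  apply: le_lt_trans (metric_triangle x (t x) y) _.
  rewrite {2}txy (metric_sym (t y)) [ltRHS]splitr; apply: ltrD.
    by apply: lt_le_trans hx _; rewrite ge_min lexx orbT.
  by apply: lt_le_trans hy _; rewrite ge_min lexx orbT.
- by move=> z /ht[+ _]; rewrite nuE.
- by move=> z /ht[_ h]; apply: lt_le_trans h _; rewrite ge_min lexx.
- apply: le_trans (h1 n n1); apply: esum_subset => z [Dz [zr Gz]]; split => //; split => //=.
  by rewrite ltNge; apply/negP => dz; exact: Gz.
Qed.

Lemma discrete_limit : exists nu, discrete_dist S nu (u n) @[n --> \oo] --> 0.
Proof.
have [nu nuE] := exists_discrete_measure countable_limit_atoms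
  limit_atoms_inj limit_atoms_mass.
exists nu; apply: discrete_dist_cvg => // r e e0.
have [N hN] := limit_close_from nuE r e0; have [M hM] := limit_close_to nuE r e0.
exists (maxn N M) => // n /=; rewrite geq_max => /andP[Nn Mn].
by split; [exact: hN|exact: hM].
Qed.

End limit.

(** * Complete metrizability *)

Section complete.
Context {R : realType} {S : rootedMetricType R}.
Hypothesis bc : boundedly_compact S.
Local Notation Z := (S * posreal R)%type.
Implicit Types (z : Z) (r e : R).

(* Along a sequence whose tails lie in such sets, no mass escapes through small
   atoms and no two atoms collide. *)
Definition controlled (k : nat) (U : set (discrete_measure S)) : Prop :=
  exists2 d : R, 0 < d & forall nu, U nu ->
    (atom_mass nu (fst @^-1` ball (point : S) k%:R `&` [set z | (wt z < d)%R]) <=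
      (k.+1%:R^-1)%:E)%E /\
    (forall z z', atomset nu z -> atomset nu z' ->
      ball (point : Z) k%:R z -> ball (point : Z) k%:R z' -> z <> z' -> d <= mdist z.1 z'.1).

(** The choice of [eta] below [expR (- k%:R)] makes every atom of [nu'] in the product ball a
    partner of an atom of [F], since its weight exceeds the leftover mass. Partners inherit half of
    the least weight [m] and half of the least distance [s] between positions in [F]. *)
Lemma controlled_local k nu :
  exists2 d : R, 0 < d & controlled k [set nu' | discrete_dist S nu nu' < d].
Proof.
pose eta : R := Num.min k.+1%:R^-1 (expR (- k%:R) / 2).
have eta0 : 0 < eta by rewrite lt_min invr_gt0 ltr0n divr_gt0// expR_gt0.
have eta1 : eta <= k.+1%:R^-1 by rewrite ge_min lexx.
have eta2 : eta < expR (- k%:R).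
  apply: (@le_lt_trans _ _ (expR (- k%:R) / 2)); first by rewrite ge_min lexx orbT.
  by rewrite gtr_pMr ?expR_gt0// invf_lt1// ltr1n.
have [F [finF FD _ hF]] := local_matching bc nu k%:R eta0.
have [s s0 hs] : exists2 s : R, 0 < s &
    forall x y : S, (fst @` F) x -> (fst @` F) y -> x <> y -> s <= mdist x y.
  by apply: finite_separation; exact: finite_image.
have [m m0 hm] := finite_lower_bound finF (fun z _ => wt_gt0 z).
pose e := Num.min (1 / 2) (s / 4).
have e0 : 0 < e by rewrite lt_min !divr_gt0.
have e1 : e <= 1 / 2 by rewrite ge_min lexx.
have e2 : e <= s / 4 by rewrite ge_min lexx orbT.
have [d d0 hd] := hF e e0; exists d => //.
exists (Num.min (m / 2) (s / 2)); first by rewrite lt_min !divr_gt0.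
move=> nu' /= /hd[t [tinj tD te rest]]; split.
  apply: (@le_trans _ _ eta%:E); last by rewrite lee_fin.
  apply: le_trans rest; apply: esum_subset => z [Dz [zr /= zd]]; split => //; split => //.
  move=> [y Fy yz]; move: zd; apply/negP; rewrite -leNgt ge_min.
  apply/orP; left; rewrite ler_pdivrMr//.
  apply: le_trans (hm y Fy) _; apply: le_trans (mdist_wt (te y Fy)) _.
  rewrite yz mulrC ler_pM2l ?wt_gt0//; apply: le_trans (expR_le1D (ltW e0) e1) _.
  by move: e1; clear; lra.
have inF z : atomset nu' z -> ball (point : Z) k%:R z -> exists2 y, F y & t y = z.
  move=> Dz zk; apply: contrapT => nz; have := ball_pair_wt zk.
  apply/negP; rewrite -leNgt (le_trans _ (ltW eta2))// -lee_fin.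
  by apply: le_trans rest; apply: atom_mass_ge => //; split => //; exact: ball_pair_fst zk.
move=> z z' Dz Dz' zk zk' zz'.
have [y Fy yz] := inF z Dz zk; have [y' Fy' yz'] := inF z' Dz' zk'.
have yy : y.1 <> y'.1.
  move=> yy; apply: zz'; rewrite -yz -yz'; congr t.
  by apply: atomset_inj yy; exact: FD.
rewrite ge_min; apply/orP; right.
have h1 : s <= mdist y.1 y'.1 by apply: hs.
have h2 : mdist y.1 z.1 < e by rewrite -yz; exact: le_lt_trans (mdist_fst _ _) (te y Fy).
have h3 : mdist z'.1 y'.1 < e.
  by rewrite -yz' metric_sym; exact: le_lt_trans (mdist_fst _ _) (te y' Fy').
have h4 := metric_triangle y.1 z.1 y'.1; have h5 := metric_triangle z.1 z'.1 y'.1.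
by move: (mdist z.1 z'.1) (mdist _ _) (mdist _ _) (mdist _ _) (mdist _ _) h1 h2 h3 h4 h5 e2
  => a1 a2 a3 a4 a5; clear -bc; lra.
Qed.

Lemma completely_metrizable_discrete :
  completely_metrizable R (metric_topology (discrete_dist S)).
Proof.
have [D [Dm Dc DE]] : exists D : discrete_measure S -> discrete_measure S -> R,
    [/\ is_metric D, complete_metric D & metric_open (discrete_dist S) = metric_open D].
  apply: (complete_metrization (is_metric_discrete_dist bc) (Q := controlled)).
  - by move=> k U V UV [d d0 h]; exists d => // nu /UV; exact: h.
  - exact: controlled_local.
  - move=> u cau ctl.
    suff [nu h] : exists nu, discrete_dist S nu (u n) @[n --> \oo] --> 0.
      by exists nu; under eq_fun do rewrite discrete_distC.
    have nat_ge (r : R) : exists k : nat, r <= k%:R.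
      exists (Num.truncn `|r|).+1; apply: le_trans (ler_norm r) _; exact/ltW/truncnS_gt.
    apply: discrete_limit => //.
    + move=> r e e0; have [d d0 hd] := discrete_dist_close bc r e0.
      have [[/= A B] [[N _ hA] [M _ hB]] hAB] := cau d d0.
      exists (maxn N M) => m n; rewrite !geq_max => /andP[Nm _] /andP[_ Mn].
      by apply: hd; apply: (hAB (m, n)); split => /=; [exact: hA|exact: hB].
    (* The index of [controlled] fixes both the radius and the precision, so it must exceed both [r]
       and [e^-1]. *)
    + move=> r e e0; have [k1 hk1] := nat_ge r; have [k2 hk2] := nat_ge e^-1.
      have [N [d d0 hN]] := ctl (maxn k1 k2).
      exists d => //; exists N => n Nn.
      have [|h _] := hN (u n); first by exists n.
      apply: (@le_trans _ _ (((maxn k1 k2).+1%:R^-1)%:E)).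
        apply: le_trans h; apply: atom_massS => z [/ball_mdistP zr zd]; split => //.
        apply/ball_mdistP; rewrite (lt_le_trans zr)// (le_trans hk1)// ler_nat leq_maxl//.
      rewrite lee_fin invf_ple ?posrE// (le_trans hk2)// ler_nat.
      by rewrite (leq_trans (leq_maxr k1 k2)).
    + move=> r; have [k hk] := nat_ge r; have [N [d d0 hN]] := ctl k.
      exists d => //; exists N => n Nn z z' Dz Dz' zr zr' zz'.
      have [|_ h] := hN (u n); first by exists n.
      by apply: h => //; [move: zr|move: zr']; exact: le_ball.
by exists D; split.
Qed.

End complete.

(** * Separability *)

Lemma countable_enum (T : pointedType) (A : set T) : countable A ->
  exists q : nat -> T, A `<=` range q.
Proof.
move=> /countable_injP[f finj]; exists (fun n => xget point [set x | A x /\ f x = n]) => x Ax.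
exists (f x) => //; have [Ag] : [set y | A y /\ f y = f x] (xget point [set y | A y /\ f y = f x]).
  by exact: (xgetI _ (x := x)).
by move=> /finj; apply; rewrite inE.
Qed.

Lemma dense_sequence (R : realType) (X : rootedMetricType R) : boundedly_compact X ->
  exists q : nat -> X, forall (x : X) (e : R), 0 < e -> exists i, mdist x (q i) < e.
Proof.
move=> bc.
have net (n k : nat) : exists F : set X, finite_set F /\
    forall x, mdist (point : X) x <= n%:R -> exists2 y, F y & mdist x y < (k.+1%:R^-1 : R).
  have k0 : 0 < (k.+1%:R^-1 : R) by rewrite invr_gt0 ltr0n.
  have : compact [set y : X | mdist (point : X) y <= n%:R] := bc point n%:R.
  rewrite compact_cover => /(_ X setT (fun x => nbh [set x] k.+1%:R^-1)) [].
  - by move=> x _; exact: nbh_open.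
  - by move=> x _; exists x => //; exact: sub_nbh.
  move=> F _ KF; exists [set` F]; split; first exact: finite_fset.
  by move=> x /KF[y Fy [_ -> xy]]; exists y.
have [F hF] := choice (fun p : nat * nat => net p.1 p.2).
have [q hq] : exists q : nat -> X, \bigcup_p F p `<=` range q.
  apply: countable_enum; apply: bigcup_countable => //.
  by move=> p _; apply: finite_set_countable; case: (hF p).
exists q => x e e0.
have [_ h] := hF ((Num.truncn (mdist point x)).+1, Num.truncn e^-1).
have [|y Fy xy] := h x; first exact/ltW/truncnS_gt.
have [|i _ iy] := hq y; first by eexists; last exact: Fy.
exists i; rewrite iy; apply: lt_trans xy _.
by rewrite invf_plt ?posrE//; exact: truncnS_gt.
Qed.

Section separable.
Context {R : realType} {S : rootedMetricType R}.
Hypothesis bc : boundedly_compact S.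
Local Notation Z := (S * posreal R)%type.
Implicit Types (z : Z) (nu : discrete_measure S) (r e : R).

(* Up to [1 / (k + 1)], and on the ball of radius [k], the measure [nu] is a finite
   sum of atoms located near the terms of [q] listed by [l], where [p = (k, l)]. *)
Definition coded (q : nat -> Z) (p : nat * seq nat) nu := exists a : seq Z,
  [/\ uniq a, forall z, z \in a -> atomset nu z, size a = size p.2,
      forall i, (i < size a)%N -> mdist (nth point a i) (q (nth 0%N p.2 i)) < p.1.+1%:R^-1 &
      (atom_mass nu (fst @^-1` ball (point : S) p.1%:R `\` [set` a]) <= (p.1.+1%:R^-1)%:E)%E].

Lemma exists_code (q : nat -> Z) k nu :
  (forall z e, 0 < e -> exists i, mdist z (q i) < e) -> exists l, coded q (k, l) nu.
Proof.
move=> hq; have k0 : 0 < (k.+1%:R^-1 : R) by rewrite invr_gt0 ltr0n.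
have [F [finF FA hF]] := atom_mass_core bc nu k%:R k0.
have [c hc] := choice (fun z => hq z _ k0).
have Fs : F = [set` enum_fset (fset_set F)].
  by apply/seteqP; split => z /=; rewrite in_fset_set// inE.
exists (map c (enum_fset (fset_set F))), (enum_fset (fset_set F)); split => /=.
- exact: fset_uniq.
- by move=> z; rewrite in_fset_set// inE => /FA[].
- by rewrite size_map.
- by move=> i ia; rewrite (nth_map point).
- by rewrite -Fs.
Qed.

(** The [i]-th atoms of the two lists are close to the same term of [q], so they are matched with
    each other. Injectivity comes from the absence of repetitions in the lists of atoms; the codes
    themselves may repeat a term of [q]. *)
Lemma coded_close (q : nat -> Z) p nu nu' r : coded q p nu -> coded q p nu' ->
  r <= p.1%:R -> 2 * p.1.+1%:R^-1 <= (1 / 2 : R) -> 2 * p.1.+1%:R^-1 < expR (- r) ->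
  discrete_close nu nu' r (2 * (2 * p.1.+1%:R^-1)).
Proof.
move=> [a [ua aD sa ca ra]] [b [ub bD sb cb rb]] rp h1 h2.
have k0 : 0 < (p.1.+1%:R^-1 : R) by rewrite invr_gt0 ltr0n.
have sab : size a = size b by rewrite sa sb.
have ib z : z \in a -> (index z a < size b)%N by rewrite -sab index_mem.
apply: (@matching_close _ _ nu nu' [set` a] (fun z => nth point b (index z a))) => //.
- move=> x y; rewrite !inE/= => xa ya /eqP; rewrite nth_uniq ?ib// => /eqP ij.
  by rewrite -(nth_index point xa) -(nth_index point ya) ij.
- by move=> z /= za; apply/bD/mem_nth/ib.
- move=> z /= za; apply: le_lt_trans (metric_triangle _ (q (nth 0%N p.2 (index z a))) _) _.
  rewrite mulr_natl mulr2n; apply: ltrD.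
    by rewrite -{1}(nth_index point za); apply: ca; rewrite index_mem.
  by rewrite metric_sym; apply: cb; exact: ib.
- apply: (@le_trans _ _ (p.1.+1%:R^-1)%:E).
    apply: le_trans ra; apply: atom_massS => z [/ball_mdistP zr za]; split => //.
    by apply/ball_mdistP; rewrite (lt_le_trans zr).
  by rewrite lee_fin ler_peMl ?ltW// ltr1n.
Qed.

(** The dense set consists of one measure per code, picked among those that have this code. Building
    measures with atoms at the terms of [q] would instead require distinct positions. *)
Lemma separable_discrete : separable (metric_topology (discrete_dist S)).
Proof.
have [q hq] := dense_sequence (@boundedly_compact_pair R S bc).
have [nu0 _] : exists nu, atomset nu = set0.
  by apply: exists_discrete_measure => // r; rewrite set0I esum_set0.
have [f hf] : {f : nat * seq nat -> discrete_measure S &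
    forall p, (exists nu, coded q p nu) -> coded q p (f p)}.
  apply: (@choice _ _ (fun p nu => (exists nu, coded q p nu) -> coded q p nu)) => p.
  have [[nu pnu]|h] := pselect (exists nu, coded q p nu); last by exists nu0.
  by exists nu.
exists (range f).
  by apply: sub_countable (card_image_le _ _) _; exact: countableP.
move=> U [nu Unu] oU.
have [e e0 he] : exists2 e : R, 0 < e & [set y | discrete_dist S nu y < e] `<=` U by exact: oU.
have [l hl] := choice (fun k => exists_code k nu hq).
have fc k : coded q (k, l k) (f (k, l k)) by apply: hf; exists nu; exact: hl.
suff : discrete_dist S nu (f (k, l k)) @[k --> \oo] --> 0.
  move=> /cvgrPdist_lt/(_ _ e0)[N _ hN].
  exists (f (N, l N)); split; last by exists (N, l N).
  apply: he => /=; have := hN N (leqnn N).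
  by rewrite /= sub0r normrN; apply: le_lt_trans; exact: ler_norm.
apply: discrete_dist_cvg => // r d d0.
have cv0 : (k.+1%:R^-1 : R) @[k --> \oo] --> 0 by exact: cvg_harmonic.
have small (c : R) : 0 < c -> \forall k \near \oo, 2 * (2 * k.+1%:R^-1) < c.
  move=> c0; have c4 : 0 < c / 4 by rewrite divr_gt0.
  have /cvgrPdist_lt/(_ _ c4) := cv0; apply: filterS => k.
  rewrite sub0r normrN ger0_norm ?invr_ge0// => kc.
  by rewrite mulrA -natrM mulrC -ltr_pdivlMr.
near=> k.
have h1 : 2 * (2 * k.+1%:R^-1) < d by near: k; exact: small.
have k0 : 0 < (k.+1%:R^-1 : R) by rewrite invr_gt0 ltr0n.
have h2 : 2 * k.+1%:R^-1 <= (1 / 2 : R).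
  have : 2 * (2 * k.+1%:R^-1) < (1 : R) by near: k; exact: small.
  move: (_.+1%:R^-1) => c; clear; lra.
have h3 : 2 * k.+1%:R^-1 < expR (- r).
  have : 2 * (2 * k.+1%:R^-1) < expR (- r) by near: k; apply: small; rewrite expR_gt0.
  by move: k0; move: (_.+1%:R^-1) => c; clear; lra.
have h4 : r <= k%:R by near: k; exact: nbhs_infty_ger.
have d1 : 0 <= 2 * (2 * k.+1%:R^-1) :> R by rewrite !mulr_ge0// ltW.
by split; apply: (discrete_close_mono d1 (lexx r) (ltW h1));
  apply: (coded_close (q := q) (p := (k, l k))).
Unshelve. all: by end_near. Qed.

End separable.

(** * Incompleteness over the real line *)

HB.instance Definition _ (R : realType) := Metric.on R^o.

Section collision.
Context {R : realType}.

Definition line : rootedMetricType R := R^o.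

Lemma mdist_line (x y : line) : mdist x y = `|(y : R) - x|. Proof. by []. Qed.

Lemma boundedly_compact_line : boundedly_compact line.
Proof.
move=> x r.
have -> : [set y : line | mdist x y <= r] = `[(x : R) - r, (x : R) + r]%classic.
  by apply/seteqP; split => y /=; rewrite mdist_line in_itv/= ler_distl.
exact: segment_compact.
Qed.

Local Notation Z := (line * posreal R)%type.

Definition double_dirac (X : rootedMetricType R) (x : X) : {measure set (borel X) -> \bar R} :=
  mscale (2%:R%:nng : {nonneg R}) (\d_(x : borel X)).

Lemma double_diracE (X : rootedMetricType R) (x : X) (A : set (borel X)) :
  double_dirac x A = (2 * (x \in A)%:R)%:E.
Proof.
transitivity ((2%:R : R)%:E * (\d_(x : borel X) A : \bar R))%E; first by exact: erefl.
by rewrite diracE.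
Qed.

Lemma double_dirac_locally_finite (X : rootedMetricType R) (x : X) :
  locally_finite (double_dirac x).
Proof. by move=> r; rewrite double_diracE ltry. Qed.

(** A set containing either point has both points in its [e]-neighbourhood. *)
Lemma double_dirac_close (X : rootedMetricType R) (x y : X)
    (mu : {measure set (borel X) -> \bar R}) r e : mdist x y < e ->
  (forall A : set (borel X), measurable A -> mu A = ((x \in A)%:R + (y \in A)%:R)%:E) ->
  vague_close (double_dirac x) mu r e /\ vague_close mu (double_dirac x) r e.
Proof.
move=> xy muE; have e0 : 0 < e by apply: le_lt_trans xy; exact: mdist_ge0.
have mN (A : set X) : measurable (nbh A e : set (borel X)) by exact: borel_nbh.
have nx (A : set X) : A x \/ A y -> x \in nbh A e.
  by move=> [Ax|Ay]; apply/mem_set; [apply: sub_nbh|exists y].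
split => A mA _; rewrite muE ?double_diracE//.
  have [/set_mem Ax|Ax] := boolP (x \in A); last first.
    by rewrite mulr0 -EFinM -EFinD lee_fin addr_ge0 ?mulr_ge0 ?addr_ge0// ltW.
  have -> : y \in nbh A e by apply/mem_set; exists x => //; rewrite metric_sym.
  rewrite nx; last by left.
  by rewrite /= -EFinM -EFinD lee_fin; move: e0; clear; lra.
have [/asboolP h|/asboolPn h] := boolP `[< A x \/ A y >].
  rewrite nx// mulr1 -EFinM -EFinD lee_fin.
  have : ((x \in A)%:R + (y \in A)%:R : R) <= 2.
    by rewrite -natrD ler_nat; case: (x \in A); case: (y \in A).
  by move: (_ + _%:R) e0 => c; clear; lra.
rewrite memNset; last by move=> Ax; apply: h; left.
rewrite memNset; last by move=> Ay; apply: h; right.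
by rewrite addr0 -EFinM -EFinD lee_fin addr_ge0 ?mulr_ge0 ?addr_ge0// ltW.
Qed.

Lemma esum_pair (T : choiceType) (x y : T) (P : set T) : x <> y ->
  (\esum_(z in [set x; y] `&` P) 1 = ((x \in P)%:R + (y \in P)%:R : R)%:E)%E.
Proof.
move=> xy; rewrite esum_mkcondr (esumID [set x]); last by move=> z _; case: ifP.
rewrite (_ : _ `&` [set x] = [set x]); last first.
  by apply/seteqP; split => [z []//|_ ->]; split => //; left.
rewrite (_ : _ `&` ~` [set x] = [set y]); last first.
  by apply/seteqP; split => [z [[]//]|_ ->]; split; [right|exact/nesym].
by rewrite !esum_set1; [case: (x \in P); case: (y \in P)|case: ifP..].
Qed.

Definition unit_atom (x : R) : Z := (x : line, 1%:pos : {posnum R}).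

Lemma exists_unit_pair (x : R) : 0 <> x -> exists nu : discrete_measure line,
  (forall A : set (borel line), measurable A ->
    nu A = (((0 : line) \in A)%:R + ((x : line) \in A)%:R)%:E) /\
  (forall A : set (borel Z), measurable A ->
    point_process nu A = ((unit_atom 0 \in A)%:R + (unit_atom x \in A)%:R)%:E).
Proof.
move=> x0; pose D : set Z := [set unit_atom 0; unit_atom x].
have ux : unit_atom 0 <> unit_atom x by move=> [].
have w1 z : D z -> wt z = 1 by case=> ->.
have DE (B : set Z) : \esum_(z in D `&` B) (wt z)%:E =
    ((unit_atom 0 \in B)%:R + (unit_atom x \in B)%:R)%:E.
  by rewrite -esum_pair//; apply: eq_esum => z [/w1 -> _].
have [nu nuD] : exists nu, atomset nu = D.
  apply: exists_discrete_measure.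
  - by apply: finite_set_countable; exact: finite_set2.
  - by move=> z z' [->|->] [->|->]//= h; case: x0.
  - by move=> r; rewrite DE ltry.
exists nu; split => A mA.
  by rewrite discreteE// nuD DE.
by rewrite point_processE nuD esum_pair.
Qed.

Lemma incomplete_line : ~ complete_metric (discrete_dist line).
Proof.
have bc := boundedly_compact_line.
pose x n : R := n.+1%:R^-1.
have x0 n : 0 < x n by rewrite /x invr_gt0 ltr0n.
have cvx : x n @[n --> \oo] --> (0 : R) by exact: cvg_harmonic.
have xn0 n : 0 <> x n by move=> h; have := x0 n; rewrite -h ltxx.
have [nu hnu] := choice (fun n => exists_unit_pair (xn0 n)).
have near_x (e : R) : 0 < e -> \forall n \near \oo, x n < e.
  move=> e0; have /cvgrPdist_lt/(_ _ e0) := cvx; apply: filterS => n.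
  by rewrite sub0r normrN gtr0_norm.
have cv1 : vague_dist (double_dirac (0 : line)) (nu n) @[n --> \oo] --> 0.
  apply: vague_dist_cvg => [||r e e0].
  - exact: double_dirac_locally_finite.
  - by move=> n; exact: discrete_locally_finite.
  - apply: filterS (near_x e e0) => n xe.
    apply: double_dirac_close; last exact: (hnu n).1.
    by rewrite mdist_line subr0 gtr0_norm.
have cv2 : vague_dist (double_dirac (unit_atom 0)) (point_process (nu n)) @[n --> \oo] --> 0.
  apply: vague_dist_cvg => [||r e e0].
  - exact: double_dirac_locally_finite.
  - by move=> n; exact: point_process_locally_finite.
  - apply: filterS (near_x e e0) => n xe.
    apply: double_dirac_close; last exact: (hnu n).2.
    by rewrite mdist_pairE subrr normr0 gt_max e0 andbT mdist_line subr0 /= gtr0_norm.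
have lf1 n : locally_finite (nu n) by exact: discrete_locally_finite.
have lf2 (mu : discrete_measure line) : locally_finite (point_process mu).
  exact: point_process_locally_finite.
have lfd := @double_dirac_locally_finite.
have close (e : R) : 0 < e -> exists N, forall n, (N <= n)%N ->
    vague_dist (double_dirac (0 : line)) (nu n) < e /\
    vague_dist (double_dirac (unit_atom 0)) (point_process (nu n)) < e.
  move=> e0.
  have /cvgrPdist_lt/(_ _ e0)[N _ hN] := cv1; have /cvgrPdist_lt/(_ _ e0)[M _ hM] := cv2.
  exists (maxn N M) => n; rewrite geq_max => /andP[/hN + /hM].
  rewrite /= !sub0r !normrN => h1 h2.
  by split; [apply: le_lt_trans h1|apply: le_lt_trans h2]; exact: ler_norm.
have half (e : R) : 0 < e -> exists2 d, 0 < d & d + d = e.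
  by move=> e0; exists (e / 2); rewrite ?divr_gt0// -splitr.
move=> /(_ nu) [].
  (* For the Cauchy property, each half of the distance goes through its own double Dirac mass. *)
  move=> e e0; have [d d0 dE] := half e e0.
  have [N hN] := close _ d0.
  exists ([set n | (N <= n)%N], [set n | (N <= n)%N]); first by split; exists N.
  move=> [m n] [/= /hN[m1 m2] /hN[n1 n2]].
  rewrite vague_distC in m1; rewrite vague_distC in m2.
  rewrite /discrete_dist gt_max; apply/andP; split.
    apply: le_lt_trans (vague_dist_triangle (lf1 m) (lfd _ (0 : line)) (lf1 n)) _.
    by rewrite -dE; exact: ltrD m1 n1.
  apply: le_lt_trans (vague_dist_triangle (lf2 (nu m)) (lfd _ (unit_atom 0)) (lf2 (nu n))) _.
  by rewrite -dE; exact: ltrD m2 n2.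
move=> l ll.
have h0 : vague_dist (point_process l) (double_dirac (unit_atom 0)) = 0.
  apply/eqP; rewrite eq_le vague_dist_ge0 andbT; apply/ler_addgt0Pl => e e0; rewrite addr0.
  have [d d0 dE] := half e e0.
  have [N hN] := close _ d0; have /cvgrPdist_lt/(_ _ d0)[M _ hM] := ll.
  have [_ h1] := hN _ (leq_maxl N M); have := hM _ (leq_maxr N M).
  rewrite /= sub0r normrN => /(le_lt_trans (ler_norm _)).
  rewrite /discrete_dist gt_max vague_distC => /andP[_ h2].
  apply: le_trans (vague_dist_triangle (lf2 l) (lf2 (nu (maxn N M))) (lfd _ (unit_atom 0))) _.
  rewrite vague_distC in h2; rewrite vague_distC in h1.
  by rewrite -dE; exact: lerD (ltW h2) (ltW h1).
have := vague_dist_eq0 (lf2 l) (lfd Z (unit_atom 0)) h0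
  (@borel_set1 R (Z : rootedMetricType R) (unit_atom 0)).
rewrite double_diracE mem_set// mulr1 point_processE => h.
(* The atoms form a set, so the point process of [l] gives each point mass at most 1, whereas the
   limit gives mass 2. *)
have : (\esum_(z in atomset l `&` [set unit_atom 0]) 1 <= 1 :> \bar R)%E.
  rewrite -[leRHS](esum_set1 (t := unit_atom 0) (a := fun=> 1%E))//.
  by apply: esum_subset; exact: subIsetr.
by rewrite h lee_fin; clear; lra.
Qed.

End collision.

Theorem theorem2p21 (R : realType) :
  (forall S : rootedMetricType R, boundedly_compact S ->
     is_metric (discrete_dist S) /\
     polish R (metric_topology (discrete_dist S))) /\
  (exists2 S : rootedMetricType R, boundedly_compact S &
     ~ complete_metric (discrete_dist S)).
Proof.
split; last by exists line; [exact: boundedly_compact_line|exact: incomplete_line].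
move=> S bc; split; first exact: is_metric_discrete_dist.
by split; [exact: separable_discrete|exact: completely_metrizable_discrete].
Qed.
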